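(* (i) There is an absolute constant $C>0$ such that for every integer $N\geq 10$ there exist a uniformly convex sequence $\{a_n\}_{n=1}^N$ (with parameter $N$) and a sequence of complex numbers $\{b_n\}_{n=1}^N$ such that \[ \left\| \sup_{t\in [0,N^2]} \left|\sum_{n=1}^N b_n e \left(x\frac{n}{N} + ta_n \right) \right| \right\|_{L^4([0,N])} \geq C N^{\frac{7}{12}} \Big(\sum_{n=1}^N |b_n|^2\Big)^{1/2}, \] where the $L^4([0,N])$ norm is taken in the variable $x$. (ii) For every $\epsilon>0$ there exists $C_\epsilon>0$ such that for every integer $N\geq 1$, every uniformly convex sequence $\{a_n\}_{n=1}^N$ (with parameter $N$) and every sequence of complex numbers $\{b_n\}_{n=1}^N$, \[ \left\| \sup_{t\in [0,N^2]} \left|\sum_{n=1}^N b_n e \left(x\frac{n}{N} + ta_n \right) \right| \right\|_{L^4([0,N])} \leq C_\epsilon N^\epsilon N^{\frac{7}{12}} \Big(\sum_{n=1}^N |b_n|^2\Big)^{1/2}. \]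
   Context: $e(x):=e^{2\pi i x}$. A real sequence $\{a_n\}_{n=1}^N$ is called uniformly convex (with parameter $N$) if for all admissible $n$: $a_{n+1}-a_n\in[\frac{1}{4N},\frac{4}{N}]$ and $(a_{n+2}-a_{n+1})-(a_{n+1}-a_n)\in[\frac{1}{4N^2},\frac{4}{N^2}]$. *)

(* Defs.v *)
From HB Require Import structures.
From mathcomp Require Import all_boot all_order all_algebra.
From mathcomp Require Import all_classical all_reals all_analysis.
Set Implicit Arguments. Unset Strict Implicit. Unset Printing Implicit Defensive.
Import Order.TTheory GRing.Theory Num.Theory.
Local Open Scope classical_set_scope.
Local Open Scope ring_scope.

Section Defs.
Variable R : realType.

Definition unif_convex (N : nat) (a : nat -> R) : Prop :=
  (forall n : nat, (1 <= n)%N -> (n + 1 <= N)%N ->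
     (4 * N%:R)^-1 <= a n.+1 - a n <= 4 / N%:R) /\
  (forall n : nat, (1 <= n)%N -> (n + 2 <= N)%N ->
     (4 * N%:R ^+ 2)^-1 <= (a n.+2 - a n.+1) - (a n.+1 - a n)
       <= 4 / N%:R ^+ 2).

(* Complex coefficients b_n = br n + i * bi n.  e(y) = cos(2 pi y) + i sin(2 pi y). *)
Definition phase (N : nat) (a : nat -> R) (x t : R) (n : nat) : R :=
  2 * pi * (x * (n%:R / N%:R) + t * a n).

Definition esum_re (N : nat) (a br bi : nat -> R) (x t : R) : R :=
  \sum_(1 <= n < N.+1)
     (br n * cos (phase N a x t n) - bi n * sin (phase N a x t n)).
Definition esum_im (N : nat) (a br bi : nat -> R) (x t : R) : R :=
  \sum_(1 <= n < N.+1)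
     (br n * sin (phase N a x t n) + bi n * cos (phase N a x t n)).

Definition esum_abs (N : nat) (a br bi : nat -> R) (x t : R) : R :=
  Num.sqrt (esum_re N a br bi x t ^+ 2 + esum_im N a br bi x t ^+ 2).

Definition maxfun (N : nat) (a br bi : nat -> R) (x : R) : R :=
  sup [set esum_abs N a br bi x t | t in `[0, N%:R ^+ 2]%classic].

Definition L4norm (N : nat) (f : R -> R) : \bar R :=
  let D : set R := `[0%R, N%:R]%classic in
  poweR (\int[lebesgue_measure]_(x in D) ((f x) ^+ 4)%:E)%E (4^-1).

Definition l2norm (N : nat) (br bi : nat -> R) : R :=
  Num.sqrt (\sum_(1 <= n < N.+1) (br n ^+ 2 + bi n ^+ 2)).

End Defs.

(* Main.v *)
Require Import Defs.
From HB Require Import structures.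
From mathcomp Require Import all_boot all_order all_algebra.
From mathcomp Require Import all_classical all_reals all_analysis.
From mathcomp Require Import measurable_realfun complex.
From mathcomp Require Import ring lra zify.
Import Order.TTheory GRing.Theory Num.Theory.
Import numFieldNormedType.Exports.
Local Open Scope ring_scope.

(** Upper bound.  By Hölder it suffices to bound the sixth moment of the
    maximal function.  The frequencies [a n] are rounded to multiples of
    [1 / (160 N^2)], so that [x] and [t] can be sampled on a finite group on
    which the rounded characters are exactly orthogonal; passing from the grid
    back to the supremum costs a perturbation of the phases which is absorbed
    with the mean value theorem.  On the group the required discrete
    restriction estimate is an l^2 decoupling theorem for a convex curve.  It is
    proved by bilinear efficient congruencing: for separated intervals [I], [J]
    the sum over [I] in [sum_x |F_I|^2 |F_J|^4] splits orthogonally into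
    intervals of length about [|J|^2 / dist(I,J)], after which Cauchy-Schwarz
    exchanges the roles of the two intervals.  Iterating this, and comparing
    with the linear estimate by a broad-narrow argument, improves any admissible
    exponent [lam >= eps] by a fixed amount.

    Lower bound.  With [q ~ 2 N^(1/3)], [b = 1] on the multiples of [q] and
    [a n = n^2 / N^2 + beta n - n q^2 / (8 N^3)], where [beta ~ 1 / N] makes
    [(N / q)^2 q beta] an integer, there is for every [x] a time
    [t] at which all [N / q] terms have nearly the same argument. *)

(** * Squared moduli of complex numbers and Cauchy-Schwarz *)

Section SquaredModulus.
Context {R : realType}.
Implicit Types z : R[i].

(** Real-valued, so that inequalities live in the total order of [R] rather than in [R[i]]. *)
Definition sqn z : R := complex.Re z ^+ 2 + complex.Im z ^+ 2.

Lemma sqn_ge0 z : 0 <= sqn z.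
Proof. by rewrite addr_ge0 ?sqr_ge0. Qed.

Lemma sqnE z : ((sqn z)%:C = z * z^*)%C.
Proof. by rewrite add_Re2_Im2 sqr_normc. Qed.

Lemma sqn0 : sqn 0 = 0.
Proof. by rewrite /sqn /= expr0n addr0. Qed.

Lemma sqnM z1 z2 : sqn (z1 * z2) = sqn z1 * sqn z2.
Proof. case: z1 => a b; case: z2 => c d; rewrite /sqn /=; ring. Qed.

Lemma sqnD_le z1 z2 : sqn (z1 + z2) <= 2 * (sqn z1 + sqn z2).
Proof.
case: z1 => a b; case: z2 => c d; rewrite /sqn /= -subr_ge0.
rewrite (_ : _ - _ = (a - c) ^+ 2 + (b - d) ^+ 2); last by ring.
by rewrite addr_ge0 ?sqr_ge0.
Qed.

(** Lagrange's identity: the difference of the two sides is half the double sum of the nonnegative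
    terms [w i * w j * (a i * b j - a j * b i) ^+ 2]. *)
Lemma cauchy_schwarz_sum (I : finType) (w a b : I -> R) :
  (forall i, 0 <= w i) ->
  (\sum_i w i * a i * b i) ^+ 2 <=
  (\sum_i w i * a i ^+ 2) * (\sum_i w i * b i ^+ 2).
Proof.
move=> w0; rewrite -subr_ge0.
suff -> : (\sum_i w i * a i ^+ 2) * (\sum_i w i * b i ^+ 2) -
    (\sum_i w i * a i * b i) ^+ 2 =
    2^-1 * \sum_i \sum_j w i * w j * (a i * b j - a j * b i) ^+ 2.
  rewrite mulr_ge0 ?invr_ge0 //; apply: sumr_ge0 => i _; apply: sumr_ge0 => j _.
  by rewrite mulr_ge0 ?sqr_ge0 // mulr_ge0.
apply: (@mulfI _ (2 : R)) => //; rewrite mulVKf //.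
rewrite mulrBr mulr_natl [in LHS]mulr2n {2}[_ * (\sum_i w i * b i ^+ 2)]mulrC.
rewrite expr2 !big_distrlr /= mulr_sumr -sumrN -!big_split /=.
apply: eq_bigr => i _; rewrite mulr_sumr -sumrN -!big_split /=.
by apply: eq_bigr => j _; ring.
Qed.

Lemma sqr_sum_le (k : nat) (a : 'I_k -> R) :
  (\sum_i a i) ^+ 2 <= k%:R * \sum_i a i ^+ 2.
Proof.
have := @cauchy_schwarz_sum _ (fun=> 1) (fun=> 1) a (fun=> ler01).
under eq_bigr do rewrite !mul1r.
under [X in _ <= X * _]eq_bigr do rewrite expr1n mul1r.
under [X in _ <= _ * X]eq_bigr do rewrite mul1r.
by rewrite sumr_const card_ord.
Qed.

Lemma sqn_sum_le (k : nat) (z : 'I_k -> R[i]) :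
  sqn (\sum_i z i) <= k%:R * \sum_i sqn (z i).
Proof.
rewrite /sqn !raddf_sum big_split /= mulrDr.
by rewrite lerD // sqr_sum_le.
Qed.

End SquaredModulus.

(** * Moments of exponential sums *)

Section Moments.
Context {R : realType}.
Variables (N : nat) (X : finType) (chi : nat -> X -> R[i]).
Implicit Types (c g : nat -> R[i]) (f : nat -> nat).

Definition expsum c x := \sum_(n < N) c n * chi n x.
Definition sqsum c x : R := sqn (expsum c x).
Definition l2mass c : R := \sum_(n < N) sqn (c n).
Definition mixed_moment c g : R := \sum_x sqsum c x * sqsum g x ^+ 2.
Definition sixth_moment c : R := \sum_x sqsum c x ^+ 3.
Definition restr (A : pred nat) c : nat -> R[i] := fun n => if A n then c n else 0.
Definition supp_in c (s L : nat) := forall n, c n != 0 -> (s <= n < s + L)%N.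

Lemma sqsum_ge0 c x : 0 <= sqsum c x. Proof. exact: sqn_ge0. Qed.
Lemma mass_ge0 c : 0 <= l2mass c.
Proof. by apply: sumr_ge0 => n _; exact: sqn_ge0. Qed.
Lemma mixed_ge0 c g : 0 <= mixed_moment c g.
Proof. by apply: sumr_ge0 => x _; rewrite mulr_ge0 ?exprn_ge0 ?sqsum_ge0. Qed.
Lemma sixth_ge0 c : 0 <= sixth_moment c.
Proof. by apply: sumr_ge0 => x _; rewrite exprn_ge0 ?sqsum_ge0. Qed.

Lemma restr_neq0 A c n : restr A c n != 0 -> A n /\ c n != 0.
Proof. by rewrite /restr; case: (A n); rewrite ?eqxx. Qed.

Lemma restr_blocks f k c (n : 'I_N) : (c n != 0 -> (f n < k)%N) ->
  c n = \sum_(j < k) restr (fun n => f n == j) c n.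
Proof.
move=> fk; have [cn0|cn] := eqVneq (c n) 0.
  by rewrite /restr cn0 big1 // => j _; case: ifP.
rewrite (bigD1 (Ordinal (fk cn))) //= /restr eqxx big1 ?addr0 // => j.
by rewrite -val_eqE /= eq_sym => /negbTE ->.
Qed.

Lemma expsum_blocks f k c x :
  (forall n : 'I_N, c n != 0 -> (f n < k)%N) ->
  expsum c x = \sum_(j < k) expsum (restr (fun n => f n == j) c) x.
Proof.
move=> fk; rewrite /expsum exchange_big /=; apply: eq_bigr => n _.
by rewrite {1}(@restr_blocks f k c n (fk n)) mulr_suml.
Qed.

Lemma mass_blocks f k c :
  (forall n : 'I_N, c n != 0 -> (f n < k)%N) ->
  l2mass c = \sum_(j < k) l2mass (restr (fun n => f n == j) c).
Proof.
move=> fk; rewrite /l2mass exchange_big /=; apply: eq_bigr => n _.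
have [cn0|cn] := eqVneq (c n) 0.
  by rewrite cn0 sqn0 big1 // => j _; rewrite /restr cn0; case: ifP; rewrite sqn0.
rewrite (bigD1 (Ordinal (fk n cn))) //= /restr eqxx big1 ?addr0 // => j.
by rewrite -val_eqE /= eq_sym => /negbTE ->; rewrite sqn0.
Qed.

(** Cauchy-Schwarz with weight [sqsum g]. The arguments of [mixed_moment] come back in the opposite
    order: this is the exchange of roles between the two intervals. *)
Lemma mixed_holder c g : mixed_moment c g ^+ 2 <= mixed_moment g c * sixth_moment g.
Proof.
have := @cauchy_schwarz_sum R X (sqsum g) (sqsum c) (sqsum g) (@sqsum_ge0 g).
rewrite /mixed_moment /sixth_moment.
congr (_ ^+ 2 <= _ * _); apply: eq_bigr => x _; ring.
Qed.

Hypothesis chi1 : forall n x, sqn (chi n x) = 1.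

(** Cauchy-Schwarz over at most [L] frequencies: on the support the truncated subtraction [n - s] is
    exact, so its blocks are single frequencies. *)
Lemma sqsum_le_mass c s L x : supp_in c s L -> sqsum c x <= L%:R * l2mass c.
Proof.
move=> cs; rewrite /sqsum (@expsum_blocks (fun n => n - s)%N L); last first.
  by move=> n /cs; lia.
apply: le_trans; first exact: sqn_sum_le.
rewrite ler_wpM2l //.
rewrite (@mass_blocks (fun n => n - s)%N L); last by move=> n /cs; lia.
apply: ler_sum => j _; rewrite /expsum /l2mass.
have [jN|jN] := boolP (s + j < N)%N; last first.
  rewrite big1 ?sqn0; last first.
    move=> n _; rewrite /restr; case: ifP => [/eqP nj|]; rewrite ?mul0r //.
    have [->|/cs] := eqVneq (c n) 0; rewrite ?mul0r //.
    by have := ltn_ord n; lia.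
  by apply: sumr_ge0 => n _; exact: sqn_ge0.
have H (n : 'I_N) : n != Ordinal jN -> restr (fun n => (n - s)%N == j) c n = 0.
  move=> nj; rewrite /restr; case: ifP => // /eqP e.
  have [//|/cs h] := eqVneq (c n) 0.
  by case/negP: nj; apply/eqP/val_inj => /=; lia.
rewrite (bigD1 (Ordinal jN)) //= [X in sqn (_ + X)]big1 ?addr0; last first.
  by move=> n /H ->; rewrite mul0r.
rewrite sqnM chi1 mulr1 (bigD1 (Ordinal jN)) //= lerDl.
by apply: sumr_ge0 => n _; exact: sqn_ge0.
Qed.

End Moments.

(** * Orthogonality of blocks against a fourth power *)

Section Orthogonality.
Context {R : realType}.
Variables (N : nat) (X : finType) (chi : nat -> X -> R[i]).
Implicit Types (c g : nat -> R[i]) (f : nat -> nat).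
Local Notation F := (expsum N X chi).
Local Notation Q := (sqsum N X chi).
Local Notation mixed := (mixed_moment N X chi).
Local Notation mass := (l2mass N).

(** The correlation attached to one sextuple of frequencies when |F_c|^2 |F_g|^4 is expanded. For
    characters it detects the solutions of n + u1 + u2 = m + v1 + v2 on the curve. *)
Definition sextic (n m u1 v1 u2 v2 : nat) : R[i] :=
  \sum_x (chi n x * (chi m x)^*%C) * (chi u1 x * (chi v1 x)^*%C)
         * (chi u2 x * (chi v2 x)^*%C).

Definition separated (d : nat) c g :=
  (forall n u, c n != 0 -> g u != 0 -> (n + d <= u)%N) \/
  (forall n u, c n != 0 -> g u != 0 -> (u + d <= n)%N).

(* This is the only property of the convex curve that the moment estimates use. *)
Definition transversality (kap : nat) := forall d B s n m u1 v1 u2 v2 : nat,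
  let us := [:: u1; v1; u2; v2] in
  (0 < d)%N -> (n < N)%N -> (m < N)%N ->
  (forall u, u \in us -> (u < N)%N /\ (s <= u < s + B)%N) ->
  (forall u, u \in us -> (n + d <= u /\ m + d <= u)%N) \/
  (forall u, u \in us -> (u + d <= n /\ u + d <= m)%N) ->
  (kap * B ^ 2 < d * ((n - m) + (m - n)))%N ->
  sextic n m u1 v1 u2 v2 = 0.

Lemma sum_triple_eq0 (I : finType) (A B D : I -> X -> R[i]) :
  (forall p q r, \sum_x A p x * B q x * D r x = 0) ->
  \sum_x (\sum_p A p x) * (\sum_q B q x) * (\sum_r D r x) = 0.
Proof.
move=> h; under eq_bigr do rewrite big_distrlr /= mulr_suml.
rewrite exchange_big big1 //= => p _.
under eq_bigr do rewrite big_distrlr /=.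
rewrite exchange_big big1 //= => q _.
by rewrite exchange_big big1 //= => r _.
Qed.

Lemma expsum_mulJ c c' x : F c x * (F c' x)^*%C =
  \sum_(p : 'I_N * 'I_N) (c p.1 * chi p.1 x) * (c' p.2 * chi p.2 x)^*%C.
Proof.
rewrite /expsum (rmorph_sum conjc) big_distrlr /=.
by rewrite pair_bigA.
Qed.

Lemma cross_term_eq0 c c' g :
  (forall n m u1 v1 u2 v2 : 'I_N, c n != 0 -> c' m != 0 ->
     g u1 != 0 -> g v1 != 0 -> g u2 != 0 -> g v2 != 0 ->
     sextic n m u1 v1 u2 v2 = 0) ->
  \sum_x (F c x * (F c' x)^*%C) * (F g x * (F g x)^*%C) * (F g x * (F g x)^*%C)
  = 0.
Proof.
move=> h; under eq_bigr do rewrite !expsum_mulJ.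
apply: sum_triple_eq0 => -[n m] [u1 v1] [u2 v2] /=.
under eq_bigr do rewrite !rmorphM /=.
rewrite (eq_bigr (fun x => (c n * (c' m)^*%C * g u1 * (g v1)^*%C
    * g u2 * (g v2)^*%C) * ((chi n x * (chi m x)^*%C)
    * (chi u1 x * (chi v1 x)^*%C) * (chi u2 x * (chi v2 x)^*%C)))); last first.
  by move=> x _; ring.
rewrite -mulr_sumr -/(sextic n m u1 v1 u2 v2).
have [->|cn] := eqVneq (c n) 0; first by rewrite !mul0r.
have [->|cm] := eqVneq (c' m) 0; first by rewrite rmorph0 mulr0 !mul0r.
have [->|g1] := eqVneq (g u1) 0; first by rewrite mulr0 !mul0r.
have [->|g2] := eqVneq (g v1) 0; first by rewrite rmorph0 mulr0 !mul0r.
have [->|g3] := eqVneq (g u2) 0; first by rewrite mulr0 !mul0r.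
have [->|g4] := eqVneq (g v2) 0; first by rewrite rmorph0 mulr0 !mul0r.
by rewrite h ?mulr0.
Qed.

Lemma mixedE c g : (mixed c g)%:C%C =
  \sum_x (F c x * (F c x)^*%C) * (F g x * (F g x)^*%C) * (F g x * (F g x)^*%C).
Proof.
rewrite /mixed (rmorph_sum (real_complex R)) /=; apply: eq_bigr => x _.
by rewrite rmorphM rmorphXn /= /sqsum !sqnE expr2 mulrA.
Qed.

(** Expanding |F_c|^2 into pairs of blocks, every off-diagonal pair integrates to zero against
    |F_g|^4, so the moment is additive over blocks without loss. *)
Lemma mixed_pythagoras f k c g :
  (forall n : 'I_N, c n != 0 -> (f n < k)%N) ->
  (forall n m u1 v1 u2 v2 : 'I_N, c n != 0 -> c m != 0 -> f n != f m ->
     g u1 != 0 -> g v1 != 0 -> g u2 != 0 -> g v2 != 0 ->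
     sextic n m u1 v1 u2 v2 = 0) ->
  mixed c g = \sum_(j < k) mixed (restr (fun n => f n == j) c) g.
Proof.
(* The identity is transported to [R[i]], where a squared modulus factors as z times its conjugate
   and the cross terms can be separated. *)
move=> fk h; apply: (fmorph_inj (real_complex R)).
rewrite /= mixedE (rmorph_sum (real_complex R)) /=.
under [RHS]eq_bigr => j _ do rewrite mixedE.
pose T (j j' : 'I_k) := \sum_x (F (restr (fun n => f n == j) c) x *
  (F (restr (fun n => f n == j') c) x)^*%C) *
  (F g x * (F g x)^*%C) * (F g x * (F g x)^*%C).
transitivity (\sum_j \sum_j' T j j').
  transitivity (\sum_x \sum_(j < k) \sum_(j' < k)
     (F (restr (fun n => f n == j) c) x *
     (F (restr (fun n => f n == j') c) x)^*%C) *
     (F g x * (F g x)^*%C) * (F g x * (F g x)^*%C)).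
    apply: eq_bigr => x _.
    rewrite {1 2}(expsum_blocks N X chi f k c x fk) (rmorph_sum conjc).
    rewrite big_distrlr /= -!mulrA mulr_suml; apply: eq_bigr => j _.
    by rewrite mulr_suml; apply: eq_bigr => j' _; rewrite !mulrA.
  by rewrite exchange_big; apply: eq_bigr => j _; rewrite exchange_big.
apply: eq_bigr => j _; rewrite (bigD1 j) //= big1 ?addr0 // => j' jj'.
apply: cross_term_eq0 => n m u1 v1 u2 v2 /restr_neq0[/eqP nj cn].
move=> /restr_neq0[/eqP mj' cm]; apply: h => //.
by rewrite nj mj' eq_sym; apply: contra jj' => /eqP/val_inj ->.
Qed.

End Orthogonality.

(** * Bilinear efficient congruencing *)

Section BilinearStep.
Context {R : realType}.
Variables (N : nat) (X : finType) (chi : nat -> X -> R[i]) (kap : nat).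
Hypothesis chi1 : forall n x, sqn (chi n x) = 1.
Hypothesis chiT : transversality N X chi kap.
Implicit Types (c g : nat -> R[i]) (f : nat -> nat).
Local Notation F := (expsum N X chi).
Local Notation Q := (sqsum N X chi).
Local Notation mixed := (mixed_moment N X chi).
Local Notation sixth := (sixth_moment N X chi).
Local Notation mass := (l2mass N).

(** Only [g] is localized to length [B]; [c] is constrained by the gap [d] alone. The factor [#|X|]
    normalizes sums over the group to averages. *)
Definition bilinear_bound (d B : nat) (mu : R) := forall c g s,
  supp_in g s B -> separated d c g ->
  mixed c g <= mu * (#|X|%:R * (mass c * mass g ^+ 2)).

Definition sixth_bound (L : nat) (D : R) := forall c s, supp_in c s L ->
  sixth c <= D * (#|X|%:R * mass c ^+ 3).

Lemma restr_supp b j c : (0 < b)%N ->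
  supp_in (restr (fun n => n %/ b == j)%N c) (j * b) b.
Proof.
move=> b0 n /restr_neq0[/eqP <- _].
by rewrite leq_trunc_div /= -mulSnr ltn_ceil.
Qed.

Lemma separated_restr A d c g :
  separated d c g -> separated d (restr A c) g.
Proof. by case=> h; [left|right] => n u /restr_neq0[_ cn] gu; exact: h. Qed.

Lemma separatedC d c g : separated d c g -> separated d g c.
Proof. by case=> h; [right|left] => n u *; exact: h. Qed.

Lemma mixed_restr2 (A : pred nat) f k c g :
  (forall n, A n -> (f n < k)%N) -> (forall n m, A n -> A m -> f n = f m) ->
  \sum_(r < k) mixed (restr A (restr (fun n => f n == r)%N c)) g =
  mixed (restr A c) g.
Proof.
move=> fk fA; have mixed0 c' : (forall n, c' n = 0) -> mixed c' g = 0.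
  move=> c0; rewrite /mixed_moment big1 // => x _.
  by rewrite /sqsum /expsum big1 ?sqn0 ?mul0r // => n _; rewrite c0 mul0r.
have [[a Aa]|/forallNP nA] := pselect (exists a, A a); last first.
  have A0 n : A n = false by apply/negP/nA.
  by rewrite big1 => [|r _]; rewrite mixed0 // => n; rewrite /restr A0.
rewrite (bigD1 (Ordinal (fk a Aa))) //= big1 ?addr0.
  congr (mixed _ _); apply/funext => n; rewrite /restr; case: ifP => // An.
  by rewrite (fA n a An Aa) eqxx.
move=> r; rewrite -val_eqE /= => ra; apply: mixed0 => n; rewrite /restr.
by case: ifP => // An; rewrite (fA n a An Aa) eq_sym (negbTE ra).
Qed.

(* Distinct blocks of length [b] in one residue class mod [kap + 1] are more than
   [kap * b >= kap * B^2 / d] apart, hence orthogonal against [|F_g|^4]. *)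
Lemma mixed_split d b B s c g : (0 < d)%N -> (0 < b)%N -> (B ^ 2 <= d * b)%N ->
  supp_in g s B -> separated d c g ->
  mixed c g <= kap.+1%:R *
    \sum_(j < N) mixed (restr (fun n => n %/ b == j)%N c) g.
Proof.
move=> d0 b0 Bdb gs sep.
pose cr r := restr (fun n => n %/ b %% kap.+1 == r)%N c.
have -> : \sum_(j < N) mixed (restr (fun n => n %/ b == j)%N c) g =
    \sum_(r < kap.+1) mixed (cr r) g.
  transitivity (\sum_(j < N) \sum_(r < kap.+1)
      mixed (restr (fun n => n %/ b == j)%N (cr r)) g).
    apply: eq_bigr => j _; rewrite mixed_restr2 //.
    - by move=> n _; rewrite ltn_pmod.
    - by move=> n m /eqP -> /eqP ->.
  rewrite exchange_big /=; apply: eq_bigr => r _; apply/esym.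
  apply: mixed_pythagoras => [n _|n m u1 v1 u2 v2].
    by rewrite (leq_ltn_trans (leq_div _ _)).
  move=> /restr_neq0[/eqP rn cn] /restr_neq0[/eqP rm cm] nm g1 g2 g3 g4.
  have us u : u \in [:: nat_of_ord u1; nat_of_ord v1; nat_of_ord u2;
      nat_of_ord v2] -> (u < N)%N /\ g u != 0.
    by rewrite !inE => /or4P[] /eqP ->.
  apply: (chiT d B s) => //.
  - by move=> u /us[uN /gs].
  - by case: sep => h; [left|right] => u /us[_ gu]; split; apply: h.
  - apply: (@leq_trans (d * (kap * b)).+1).
      by rewrite ltnS mulnCA leq_mul2l Bdb orbT.
    rewrite ltn_mul2l d0 /=.
    move: nm rn rm; set p := (n %/ b)%N; set q := (m %/ b)%N => pq rn rm.
    have en := divn_eq n b; have em := divn_eq m b.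
    have ln := ltn_pmod n b0; have lm := ltn_pmod m b0.
    have ep := divn_eq p kap.+1; have eq := divn_eq q kap.+1.
    rewrite -/p in en; rewrite -/q in em; rewrite rn in ep; rewrite rm in eq.
    (* Distinct integers congruent modulo [kap.+1] differ by at least [kap.+1], so [n] and [m] are
       more than [kap * b] apart. *)
    have pqk : (q + kap.+1 <= p)%N \/ (p + kap.+1 <= q)%N.
      have := ltngtP (p %/ kap.+1) (q %/ kap.+1) => -[] h; [right|left|] => //.
      - by rewrite ep eq addnAC leq_add2r -mulSnr leq_mul2r h orbT.
      - by rewrite ep eq addnAC leq_add2r -mulSnr leq_mul2r h orbT.
      - by case/eqP: pq; rewrite ep eq h.
    by case: pqk => h; have := leq_mul h (leqnn b); rewrite mulnDl mulSn; lia.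
(* The factor [kap.+1] comes from Cauchy-Schwarz over the residue classes. *)
rewrite /mixed_moment exchange_big /= mulr_sumr; apply: ler_sum => x _.
rewrite -mulr_suml mulrA ler_wpM2r ?exprn_ge0 ?sqsum_ge0 // /sqsum.
rewrite (expsum_blocks N X chi (fun n => n %/ b %% kap.+1)%N kap.+1); last first.
  by move=> n _; rewrite ltn_pmod.
exact: sqn_sum_le.
Qed.

(** With [b = 1] the splitting leaves single frequencies, for which the pointwise bound
    [sqsum_le_mass] has constant 1. *)
Lemma bilinear_base d : (0 < d)%N -> bilinear_bound d 1 kap.+1%:R.
Proof.
move=> d0 c g s gs sep.
apply: (le_trans (mixed_split d 1 1 s c g d0 _ _ gs sep)) => //.
  by rewrite exp1n muln1.
rewrite ler_wpM2l // (mass_blocks N (fun n => n %/ 1)%N N c); last first.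
  by move=> n _; rewrite divn1.
rewrite mulr_suml mulr_sumr; apply: ler_sum => j _.
rewrite /mixed_moment [leRHS]mulr_natl -sumr_const; apply: ler_sum => x _.
rewrite ler_pM ?sqsum_ge0 ?exprn_ge0 ?sqsum_ge0 //.
  have /(sqsum_le_mass N X chi chi1) := restr_supp 1 j c isT.
  by move=> /(_ x); rewrite mul1r.
rewrite lerXn2r ?nnegrE ?sqsum_ge0 ?mass_ge0 //.
by have := sqsum_le_mass N X chi chi1 _ _ _ x gs; rewrite mul1r.
Qed.

(** One round of congruencing: split [c] into blocks of length [b], exchange roles on each block by
    [mixed_holder], then apply the bilinear bound with the short block in the localized slot and the
    linear bound to [g]. In terms of the ratio to [d], the new length is the square of the old
    one. *)
Lemma bilinear_step d b B mu D :
  (0 < d)%N -> (0 < b)%N -> (B ^ 2 <= d * b)%N -> 0 <= mu -> 0 <= D ->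
  sixth_bound B D -> bilinear_bound d b mu ->
  bilinear_bound d B (kap.+1%:R * Num.sqrt (mu * D)).
Proof.
move=> d0 b0 Bdb mu0 D0 hD hmu c g s gs sep.
apply: (le_trans (mixed_split d b B s c g d0 b0 Bdb gs sep)).
rewrite -mulrA ler_wpM2l // (mass_blocks N (fun n => n %/ b)%N N c); last first.
  by move=> n _; rewrite (leq_ltn_trans (leq_div _ _)).
rewrite mulr_suml !mulr_sumr; apply: ler_sum => j _.
set cj := restr _ _.
have W0 : 0 <= #|X|%:R * (mass cj * mass g ^+ 2).
  by rewrite !mulr_ge0 ?exprn_ge0 ?mass_ge0.
rewrite -ler_sqr ?nnegrE ?mixed_ge0 ?mulr_ge0 ?exprn_ge0 ?mass_ge0 ?sqrtr_ge0 //.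
apply: (le_trans (mixed_holder _ _ _ _ _)).
rewrite exprMn sqr_sqrtr ?mulr_ge0 //.
have sep' : separated d g cj by exact/separatedC/separated_restr.
have h1 := hmu g cj _ (restr_supp b j c b0) sep'.
apply: (le_trans (ler_pM (mixed_ge0 _ _ _ _ _) (sixth_ge0 _ _ _ _) h1 (hD g s gs))).
by rewrite le_eqVlt; apply/orP; left; apply/eqP; ring.
Qed.

End BilinearStep.

(** * From bilinear to linear estimates *)

Section BroadNarrow.
Context {R : realType}.
Variables (N : nat) (X : finType) (chi : nat -> X -> R[i]).
Implicit Types (c g : nat -> R[i]) (f : nat -> nat).
Local Notation F := (expsum N X chi).
Local Notation Q := (sqsum N X chi).
Local Notation mixed := (mixed_moment N X chi).
Local Notation sixth := (sixth_moment N X chi).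
Local Notation mass := (l2mass N).

Definition near (i l : nat) := (i.-1 <= l <= i.+1)%N.

(** With S the sum of the far [q j], the far part is at most k S and S <= k qmax, so its cube is at
    most k^5 S qmax^2, a sum of products of separated pieces. The rest is (a + b)^3 <= 4 (a^3 +
    b^3). *)
Lemma cube_broad_narrow (k : nat) (near_part far_part qmax : R) (P : pred 'I_k)
    (q : 'I_k -> R) :
  0 <= near_part -> 0 <= far_part -> (forall j, 0 <= q j <= qmax) ->
  far_part <= k%:R * \sum_(j | P j) q j ->
  (2 * (near_part + far_part)) ^+ 3 <=
  32 * (near_part ^+ 3 + k%:R ^+ 5 * \sum_(j | P j) q j * qmax ^+ 2).
Proof.
move=> n0 f0 qP hf; set S := \sum_(j | P j) q j in hf.
have S0 : 0 <= S by apply: sumr_ge0 => j _; case/andP: (qP j).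
have Sk : S <= k%:R * qmax.
  rewrite (le_trans (_ : _ <= \sum_(j < k) qmax)) //.
    rewrite /S big_mkcond; apply: ler_sum => j _.
    by case: ifP => _; have /andP[q0 qm] := qP j; rewrite ?(le_trans q0 qm).
  by rewrite sumr_const card_ord mulr_natl.
have hf3 : far_part ^+ 3 <= k%:R ^+ 5 * \sum_(j | P j) q j * qmax ^+ 2.
  rewrite (le_trans (_ : _ <= (k%:R * S) ^+ 3)) //.
    by rewrite lerXn2r ?nnegrE ?mulr_ge0.
  rewrite -mulr_suml -/S.
  rewrite (_ : k%:R ^+ 5 * _ = k%:R ^+ 3 * S * (k%:R * qmax) ^+ 2); last by ring.
  rewrite (_ : _ ^+ 3 = k%:R ^+ 3 * S * S ^+ 2); last by ring.
  rewrite ler_wpM2l ?mulr_ge0 ?exprn_ge0 // lerXn2r ?nnegrE //.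
  exact: le_trans Sk.
have : 0 <= (near_part + far_part) * (near_part - far_part) ^+ 2.
  by rewrite mulr_ge0 ?addr_ge0 ?sqr_ge0.
move: hf3; set T := k%:R ^+ 5 * _ => hf3 h.
rewrite -subr_ge0 (_ : _ - _ = 24 * ((near_part + far_part) *
  (near_part - far_part) ^+ 2) + 32 * (T - far_part ^+ 3)); last by ring.
by rewrite addr_ge0 // mulr_ge0 ?subr_ge0 //.
Qed.

(** At each [x] take the dominant fine block [jm]. Coarse intervals next to the one containing it
    form the narrow part; the remaining fine blocks are separated from [jm] and give mixed
    moments. *)
Lemma sixth_broad_narrow d b K s c : (0 < b)%N -> (0 < K)%N -> d = (b * K)%N ->
  supp_in c s (K * d) ->
  sixth c <= 32 * (\sum_(i < K) sixth (restr (fun n => near i ((n - s) %/ d)) c)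
   + (K * K)%:R ^+ 5 * \sum_(j' < K * K) \sum_(j < K * K | ~~ near (j' %/ K) (j %/ K))
       mixed (restr (fun n => (n - s) %/ b == j)%N c)
             (restr (fun n => (n - s) %/ b == j')%N c)).
Proof.
move=> b0 K0 dE cs; pose fine (j : nat) := restr (fun n => (n - s) %/ b == j)%N c.
set k := (K * K)%N.
have k0 : (0 < k)%N by rewrite muln_gt0 K0.
have nd n : ((n - s) %/ d = (n - s) %/ b %/ K)%N by rewrite dE divnMA.
have fk n : c n != 0 -> ((n - s) %/ b < k)%N.
  by move=> /cs h; rewrite ltn_divLR // /k; move: h; rewrite dE; lia.
rewrite /sixth_moment; under [X in _ <= _ * (_ + _ * X)]eq_bigr do rewrite exchange_big /=.
rewrite [X in _ <= _ * (_ + _ * X)]exchange_big [X in _ <= _ * (X + _)]exchange_big /=.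
rewrite mulr_sumr -big_split /= mulr_sumr; apply: ler_sum => x _.
pose q (j : 'I_k) := Q (fine j) x.
have [jm _ qmax] := @arg_maxP _ R 'I_k (Ordinal k0) predT q isT.
have qP j : 0 <= q j <= q jm by rewrite sqsum_ge0 /=; exact: qmax.
have ik : (jm %/ K < K)%N by rewrite ltn_divLR.
pose i := Ordinal ik.
pose cn := restr (fun n => near i ((n - s) %/ d)) c.
pose cf := restr (fun n => ~~ near i ((n - s) %/ d)) c.
have Fc : F c x = F cn x + F cf x.
  rewrite /expsum -big_split; apply: eq_bigr => n _ /=.
  by rewrite -mulrDl /cn /cf /restr; case: near; rewrite /= ?addr0 ?add0r.
have Ff : F cf x = \sum_(j < k | ~~ near i (j %/ K)) F (fine j) x.
  rewrite (expsum_blocks N X chi (fun n => (n - s) %/ b)%N k); last first.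
    by move=> n /restr_neq0[_ /fk].
  rewrite [RHS]big_mkcond; apply: eq_bigr => j _ /=.
  case: ifP => jn.
    apply: eq_bigr => n _; congr (_ * _); rewrite /cf /fine /restr.
    by case: eqP => // e; rewrite nd e jn.
  rewrite /expsum big1 // => n _; rewrite /cf /restr.
  by case: eqP => [e|]; rewrite ?mul0r // nd e jn mul0r.
have hf : sqn (F cf x) <= k%:R * \sum_(j < k | ~~ near i (j %/ K)) q j.
  rewrite Ff big_mkcond (le_trans (sqn_sum_le _ _)) // ler_wpM2l //.
  rewrite [leRHS]big_mkcond; apply: ler_sum => j _.
  by case: ifP; rewrite ?sqn0.
apply: (@le_trans _ _ ((2 * (sqn (F cn x) + sqn (F cf x))) ^+ 3)).
  have h : Q c x <= 2 * (sqn (F cn x) + sqn (F cf x)).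
    by rewrite /sqsum Fc sqnD_le.
  by rewrite lerXn2r ?nnegrE ?sqsum_ge0 // (le_trans _ h) ?sqsum_ge0.
apply: (le_trans (cube_broad_narrow _ _ _ _ _ q (sqn_ge0 _) (sqn_ge0 _) qP hf)).
(* The dominant index depends on [x], so its terms are bounded by the sums over all indices. *)
rewrite ler_wpM2l // lerD //.
  rewrite (bigD1 i) //= lerDl; apply: sumr_ge0 => l _.
  by rewrite exprn_ge0 ?sqsum_ge0.
rewrite ler_wpM2l ?exprn_ge0 // [leRHS](bigD1 jm) //= lerDl.
apply: sumr_ge0 => l _; apply: sumr_ge0 => j _.
by rewrite mulr_ge0 ?exprn_ge0 ?sqsum_ge0.
Qed.

Lemma sum_near_le3 (K l : nat) : (\sum_(i < K) (near i l : nat) <= 3)%N.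
Proof.
have h1 (a : nat) : (\sum_(i < K) (i == a :> nat : nat) <= 1)%N.
  have [aK|aK] := ltnP a K.
    rewrite (bigD1 (Ordinal aK)) //= eqxx big1 // => i.
    by rewrite -val_eqE /= => /negbTE ->.
  by rewrite big1 // => i _; have := ltn_ord i; case: eqP => //; lia.
apply: (@leq_trans (\sum_(i < K) ((i == l.-1 :> nat) + (i == l :> nat) +
  (i == l.+1 :> nat)))%N).
  apply: leq_sum => i _; rewrite /near; case: andP => [[h2 h3]|_] //=.
  have : [|| i == l.-1 :> nat, i == l :> nat | i == l.+1 :> nat].
    by move: h2 h3; case: (nat_of_ord i); lia.
  by case/or3P => ->; rewrite ?addn1 ?addnS ?addSn.
rewrite !big_split /=.
exact: (leq_add (leq_add (h1 l.-1) (h1 l)) (h1 l.+1)).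
Qed.

Lemma mass_near (K d s : nat) c :
  \sum_(i < K) mass (restr (fun n => near i ((n - s) %/ d)) c) <= 3 * mass c.
Proof.
rewrite /l2mass exchange_big mulr_sumr; apply: ler_sum => n _ /=.
set l := ((n - s) %/ d)%N.
rewrite (eq_bigr (fun i : 'I_K => (near i l : nat)%:R * sqn (c n))); last first.
  by move=> i _; rewrite /restr; case: near; rewrite ?mul1r // sqn0 mul0r.
by rewrite -mulr_suml ler_wpM2r ?sqn_ge0 // -natr_sum ler_nat sum_near_le3.
Qed.

Lemma mass_restr A c : mass (restr A c) <= mass c.
Proof.
apply: ler_sum => n _; rewrite /restr; case: ifP => // _.
by rewrite sqn0 sqn_ge0.
Qed.

(** The narrow pieces have length at most [3 * d] and overlap at most three times, which gives
    [3 * D]. The broad pairs have gap at least [d] and fall under the bilinear bound. *)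
Lemma sixth_reduction d b K mu D : (0 < b)%N -> (0 < K)%N -> d = (b * K)%N ->
  0 <= mu -> 0 <= D ->
  sixth_bound N X chi (3 * d) D -> bilinear_bound N X chi d b mu ->
  sixth_bound N X chi (K * d) (32 * (3 * D + (K * K)%:R ^+ 5 * mu)).
Proof.
move=> b0 K0 dE mu0 D0 hD hmu c s cs.
have d0 : (0 < d)%N by rewrite dE muln_gt0 b0.
apply: (le_trans (sixth_broad_narrow d b K s c b0 K0 dE cs)).
rewrite -[leRHS]mulrA ler_wpM2l // [leRHS]mulrDl lerD //.
  apply: (@le_trans _ _ (\sum_(i < K) D * (#|X|%:R * (mass c ^+ 2 *
     mass (restr (fun n => near i ((n - s) %/ d)) c))))).
    apply: ler_sum => i _.
    (* For [i = 0] the predecessor is again 0, so the window starts at [s] and length [3 * d] still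
       suffices. *)
    have ns : supp_in (restr (fun n => near i ((n - s) %/ d)) c)
        (s + i.-1 * d)%N (3 * d)%N.
      move=> n /restr_neq0[/andP[h1 h2] /cs cn].
      move: h1; rewrite leq_divRL // => h1; move: h2; rewrite -ltnS ltn_divLR // => h2.
      by move: cn h1 h2; case: (nat_of_ord i) => [|i'] /=; lia.
    apply: (le_trans (hD _ _ ns)); rewrite ler_wpM2l // ler_wpM2l //.
    by rewrite exprSr ler_wpM2r ?mass_ge0 // lerXn2r ?nnegrE ?mass_ge0 // mass_restr.
  rewrite -!mulr_sumr (_ : 3 * D * _ =
    D * (#|X|%:R * (mass c ^+ 2 * (3 * mass c)))); last by ring.
  do 2! rewrite ler_wpM2l //.
  rewrite ler_wpM2l ?exprn_ge0 ?mass_ge0 //.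
  exact: mass_near.
rewrite -[leRHS]mulrA ler_wpM2l ?exprn_ge0 //.
have fk (n : 'I_N) : c n != 0 -> ((n - s) %/ b < K * K)%N.
  by move=> /cs h; rewrite ltn_divLR //; move: h; rewrite dE; lia.
pose m (j : nat) := mass (restr (fun n => (n - s) %/ b == j)%N c).
have mE : mass c = \sum_(j < K * K) m j by exact: mass_blocks.
have m0 j : 0 <= m j by exact: mass_ge0.
have mc j : m j <= mass c by exact: mass_restr.
apply: (@le_trans _ _ (\sum_(j' < K * K) \sum_(j < K * K)
   mu * (#|X|%:R * (m j * (m j' * mass c))))).
  apply: ler_sum => j' _; rewrite big_mkcond; apply: ler_sum => j _.
  case: ifP => [jj|_]; last by rewrite !mulr_ge0 ?mass_ge0.
  have gs : supp_in (restr (fun n => (n - s) %/ b == j')%N c) (s + j' * b)%N b.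
    move=> n /restr_neq0[/eqP <- /cs]; have := divn_eq (n - s)%N b.
    by have := ltn_pmod (n - s)%N b0; lia.
  apply: (le_trans (hmu _ _ _ gs _)).
    have blk (n l : nat) : ((n - s) %/ b)%N = l -> c n != 0 ->
        (s + (l %/ K) * d <= n < s + (l %/ K).+1 * d)%N.
      move=> <- /cs; rewrite -divnMA -dE.
      have := divn_eq (n - s)%N d; have := ltn_pmod (n - s)%N d0.
      by rewrite mulSn; lia.
    (* Coarse indices that are not near differ by at least 2, so a full interval of length [d] lies
       between the two blocks. *)
    move: jj; rewrite /near negb_and -!ltnNge => /orP[] h; [left|right];
      move=> n u /restr_neq0[/eqP nj cn] /restr_neq0[/eqP uj cu].
    - have /andP[_ h1] := blk _ _ nj cn; have /andP[h2 _] := blk _ _ uj cu.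
      have h3 : ((j %/ K).+2 * d <= j' %/ K * d)%N.
        rewrite leq_mul2r; apply/orP; right.
        by move: h; move: (j %/ K)%N (j' %/ K)%N => p p'; lia.
      move: h1 h2 h3; rewrite !mulSn.
      by set p := (j %/ K * d)%N; set p' := (j' %/ K * d)%N; lia.
    - have /andP[h1 _] := blk _ _ nj cn; have /andP[_ h2] := blk _ _ uj cu.
      have h3 : ((j' %/ K).+2 * d <= j %/ K * d)%N.
        rewrite leq_mul2r; apply/orP; right.
        by move: h; move: (j %/ K)%N (j' %/ K)%N => p p'; lia.
      move: h1 h2 h3; rewrite !mulSn.
      by set p := (j %/ K * d)%N; set p' := (j' %/ K * d)%N; lia.
  rewrite ler_wpM2l // ler_wpM2l // ler_wpM2l ?mass_ge0 // expr2.
  by rewrite ler_wpM2l ?mass_ge0 // mass_restr.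
rewrite le_eqVlt; apply/orP; left; apply/eqP.
under eq_bigr do rewrite -!mulr_sumr -mulr_suml -mE.
by rewrite -!mulr_sumr -mulr_suml -mE; ring.
Qed.

End BroadNarrow.

(** * Improvement of the exponent by iteration *)

Section ExponentStep.
Context {R : realType}.
Variables (N : nat) (X : finType) (chi : nat -> X -> R[i]) (kap : nat).
Hypothesis chi1 : forall n x, sqn (chi n x) = 1.
Hypothesis chiT : transversality N X chi kap.
Local Notation bilinear_bound := (bilinear_bound N X chi).
Local Notation sixth_bound := (sixth_bound N X chi).

Lemma bilinear_bound_mono d B (mu mu' : R) :
  mu <= mu' -> bilinear_bound d B mu -> bilinear_bound d B mu'.
Proof.
move=> le h c g s gs sep; apply: (le_trans (h c g s gs sep)).
by rewrite ler_wpM2r // !mulr_ge0 ?exprn_ge0 ?mass_ge0.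
Qed.

Lemma sixth_bound_mono L L' (D D' : R) :
  (L <= L')%N -> D <= D' -> sixth_bound L' D -> sixth_bound L D'.
Proof.
move=> LL le h c s cs; have cs' : supp_in c s L' by move=> n /cs; lia.
apply: (le_trans (h c s cs')).
by rewrite ler_wpM2r // !mulr_ge0 ?exprn_ge0 ?mass_ge0.
Qed.

Lemma powR_natX (K e : nat) (lam : R) :
  (K ^ e)%:R `^ lam = K%:R `^ (lam * e%:R).
Proof. by rewrite natrX -powR_mulrn // -powRrM mulrC. Qed.

(* The exponent [e_k = 2^n - 2^k - (n - k) 2^k / 2] solves the recursion
   [e_k = (2^n - 2^k) / 2 + e_(k+1) / 2], [e_n = 0] coming from [bilinear_step]. *)
Lemma bilinear_chain K n (C lam : R) : (0 < K)%N -> 1 <= C ->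
  (forall L, (0 < L)%N -> sixth_bound L (C * L%:R `^ lam)) ->
  forall j k, (k + j = n)%N ->
  bilinear_bound (K ^ 2 ^ n) (K ^ (2 ^ n - 2 ^ k))
    (kap.+1%:R ^+ 2 * C *
      K%:R `^ (lam * (2 ^+ n - 2 ^+ k - j%:R * 2 ^+ k / 2))).
Proof.
move=> K0 C1 hC; have C0 : 0 <= C by exact: le_trans C1.
have KR : K%:R != 0 :> R by rewrite pnatr_eq0 -lt0n.
elim=> [k|j IH k].
  rewrite addn0 => ->; rewrite subnn expn0.
  apply: bilinear_bound_mono (bilinear_base N X chi kap chi1 chiT _ _); last first.
    by rewrite expn_gt0 K0.
  rewrite subrr mul0r mul0r subrr mulr0 powRr0 mulr1 expr2 -mulrA.
  rewrite -[leLHS]mulr1 ler_wpM2l //.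
  have : 1 <= kap.+1%:R :> R by rewrite ler1n.
  by nra.
rewrite addnS -addSn => kn.
have kn' : (2 ^ k.+1 <= 2 ^ n)%N by rewrite leq_exp2l // -kn leq_addr.
have := bilinear_step N X chi kap chiT (K ^ 2 ^ n)
  (K ^ (2 ^ n - 2 ^ k.+1)) (K ^ (2 ^ n - 2 ^ k)) _ _ _ _ _ _ _
  (hC (K ^ (2 ^ n - 2 ^ k))%N _) (IH k.+1 kn).
have eB : ((K ^ (2 ^ n - 2 ^ k)) ^ 2 <= K ^ 2 ^ n * K ^ (2 ^ n - 2 ^ k.+1))%N.
  rewrite -expnM -expnD leq_pexp2l //; move: kn'; rewrite expnS.
  by set p := (2 ^ n)%N; set q := (2 ^ k)%N; lia.
move=> /(_ _ _ eB).
rewrite !expn_gt0 K0 !mulr_ge0 ?powR_ge0 ?exprn_ge0 //.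
move=> /(_ isT isT isT isT isT); apply: bilinear_bound_mono.
rewrite powR_natX natrB; last by rewrite leq_exp2l //; lia.
rewrite !natrX -[_ * (C * _)]mulrACA -powRD ?KR ?implybT //.
set a := (X in _ `^ X); set b := (X in _ <= _ * _ `^ X).
have -> : a = b + b by rewrite /a /b exprS -natr1; field.
rewrite powRD ?KR ?implybT //.
(* The constant [kap.+1 ^+ 2 * C] is a fixed point of the recursion, so it does not grow with the
   number of rounds. *)
rewrite [X in Num.sqrt X](_ : _ = (kap.+1%:R * C * K%:R `^ b) ^+ 2); last by ring.
rewrite sqrtr_sqr ger0_norm ?mulr_ge0 ?powR_ge0 //.
by rewrite expr2 !mulrA.
Qed.

(* [K^10] is lost in the broad part, [K^(lam n / 2)] is gained by the chain. *)
Lemma sixth_gain K n (C lam dl : R) : (0 < K)%N -> 1 <= C ->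
  0 < dl -> dl <= 1 -> dl <= lam -> lam <= 3 -> 22 <= lam * n%:R ->
  (forall L, (0 < L)%N -> sixth_bound L (C * L%:R `^ lam)) ->
  sixth_bound (K ^ (2 ^ n + 1))
    (32 * (81 + kap.+1%:R ^+ 2) * C * K%:R `^ (lam * (2 ^+ n + 1) - dl)).
Proof.
move=> K0 C1 dl0 dl1 dll l3 ln hC; have C0 : 0 <= C by exact: le_trans C1.
have K1 : 1 <= K%:R :> R by rewrite ler1n.
have KR : K%:R != 0 :> R by rewrite pnatr_eq0 -lt0n.
have p1 : (1 <= 2 ^ n)%N by rewrite expn_gt0.
have dE : (K ^ 2 ^ n = K ^ (2 ^ n - 1) * K)%N.
  by rewrite -expnSr subn1 prednK.
have d0 : (0 < K ^ 2 ^ n)%N by rewrite expn_gt0 K0.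
have hmu := bilinear_chain K n C lam K0 C1 hC n 0 (add0n n).
have := sixth_reduction N X chi (K ^ 2 ^ n) (K ^ (2 ^ n - 1)) K _ _ _ K0 dE _ _
  (hC (3 * K ^ 2 ^ n)%N _) hmu.
rewrite !expn_gt0 muln_gt0 d0 K0 !mulr_ge0 ?powR_ge0 ?exprn_ge0 //.
move=> /(_ isT isT isT isT); rewrite addn1 expnS; apply: sixth_bound_mono => //.
set Y := K%:R `^ (lam * (2 ^+ n + 1) - dl).
rewrite [leRHS](_ : _ = 32 * (C * (81 * Y) + kap.+1%:R ^+ 2 * C * Y)); last by ring.
rewrite ler_wpM2l // lerD //.
  (* Narrow part: [3 * 3 ^ lam <= 81] since [lam <= 3], and the shorter length saves [K ^ lam], at
     least [K ^ dl]. *)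
  rewrite natrM powRM // powR_natX mulrCA ler_wpM2l //.
  rewrite mulrA ler_pM ?mulr_ge0 ?powR_ge0 //.
    have : (3 : R) `^ lam <= 3 `^ 3 by rewrite ler_powR // ler1n.
    have -> : (3 : R) `^ 3 = 27 by rewrite (powR_mulrn 3) //; ring.
    lra.
  rewrite ler_powR // natrX; lra.
(* Broad part: the exponent inequality reduces to 10 + dl <= 11 <= lam n / 2. *)
rewrite natrM -expr2 -exprM mulrCA ler_wpM2l ?mulr_ge0 ?exprn_ge0 //.
rewrite -powR_mulrn // -powRD ?KR ?implybT // ler_powR //.
rewrite expr0; nra.
Qed.

End ExponentStep.

(** The constant is uniform in [N], the group and the characters; only [kap] and [lam] may influence
    it. *)
Definition sixth_exponent (R : realType) (kap : nat) (lam : R) :=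
  exists2 C : R, 1 <= C &
  forall (N : nat) (X : finType) (chi : nat -> X -> R[i]),
    (forall n x, sqn (chi n x) = 1) -> transversality N X chi kap ->
    forall L, (0 < L)%N -> sixth_bound N X chi L (C * L%:R `^ lam).

Lemma sixth_exponent_mono (R : realType) kap (lam lam' : R) :
  lam <= lam' -> sixth_exponent R kap lam -> sixth_exponent R kap lam'.
Proof.
move=> le [C C1 h]; exists C => // N X chi chi1 chiT L L0.
apply: sixth_bound_mono (h N X chi chi1 chiT L L0) => //.
by rewrite ler_wpM2l ?(le_trans _ C1) // ler_powR // ler1n.
Qed.

Lemma sixth_exponent3 (R : realType) kap : sixth_exponent R kap 3.
Proof.
exists 1 => // N X chi chi1 chiT L L0 c s cs.
rewrite mul1r mulrCA /sixth_moment [leRHS]mulr_natl -sumr_const; apply: ler_sum => x _.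
rewrite (powR_mulrn 3) // -exprMn.
rewrite lerXn2r ?nnegrE ?sqsum_ge0 ?mulr_ge0 ?mass_ge0 //.
exact: (sqsum_le_mass N X chi chi1 c s L x cs).
Qed.

(** Rounds a length up to a perfect [m]-th power. The least admissible [K] works, because K <= 2 (K
    - 1) once K >= 2 and (K - 1)^m < L by minimality. *)
Lemma expn_cover (m L : nat) : (0 < m)%N -> (0 < L)%N ->
  exists K, [/\ (0 < K)%N, (L <= K ^ m)%N & (K ^ m <= 2 ^ m * L)%N].
Proof.
move=> m0 L0; have ex : exists K, (L <= K ^ m)%N.
  by exists L; rewrite -{1}[L]expn1 leq_pexp2l.
case: (ex_minnP ex) => K LK Kmin; exists K.
have K0 : (0 < K)%N.
  by case: K LK {Kmin} => //; rewrite exp0n // leqNgt L0.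
split=> //; have [K1|K1] := leqP K 1.
  have -> : K = 1%N by apply/eqP; rewrite eqn_leq K1.
  by rewrite exp1n muln_gt0 expn_gt0 L0.
apply: (@leq_trans ((2 * K.-1) ^ m)); first by rewrite leq_exp2r //; lia.
rewrite expnMn leq_mul2l; apply/orP; right; apply/ltnW; rewrite ltnNge.
by apply/negP => /Kmin; lia.
Qed.

(** With m = 2^n + 1, [sixth_gain] saves [K ^ dl] at length [K ^ m], that is a power [dl / m] of the
    length. Other lengths are rounded up by [expn_cover], at a cost depending on [m] only. *)
Lemma sixth_exponent_step (R : realType) kap (lam dl : R) n :
  0 < dl -> dl <= 1 -> dl <= lam -> lam <= 3 -> 22 <= lam * n%:R ->
  sixth_exponent R kap lam -> sixth_exponent R kap (lam - dl / (2 ^+ n + 1)).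
Proof.
move=> dl0 dl1 dll l3 ln [C C1 h]; have C0 : 0 <= C by exact: le_trans C1.
pose m := (2 ^ n + 1)%N; have mE : 2 ^+ n + 1 = m%:R :> R by rewrite natrD natrX.
have m0 : 0 < m%:R :> R by rewrite ltr0n /m addn1.
have e0 : 0 <= lam - dl / m%:R.
  rewrite subr_ge0 (le_trans _ dll) // ler_pdivrMr // ler_peMr ?(ltW dl0) //.
  by rewrite ler1n /m addn1.
set A := 32 * (81 + kap.+1%:R ^+ 2) * C.
have A1 : 1 <= A.
  have : 0 <= kap.+1%:R ^+ 2 :> R by exact: sqr_ge0.
  by rewrite /A; nra.
have pw1 : 1 <= (2 ^ m)%:R `^ (lam - dl / m%:R).
  by rewrite -[leLHS](powRr0 (2 ^ m)%:R) ler_powR // ler1n expn_gt0.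
exists (A * (2 ^ m)%:R `^ (lam - dl / m%:R)); first by nra.
move=> N X chi chi1 chiT L L0.
have m1 : (0 < m)%N by rewrite /m addn1.
have [K [K0 LK KL]] := expn_cover m L m1 L0.
have := sixth_gain N X chi kap chi1 chiT K n C lam dl K0 C1 dl0 dl1 dll l3 ln
  (h N X chi chi1 chiT).
apply: sixth_bound_mono => //.
rewrite -/A mE -[leRHS]mulrA ler_wpM2l ?(le_trans _ A1) //.
rewrite -powRM // -natrM.
have -> : lam * m%:R - dl = (lam - dl / m%:R) * m%:R.
  by rewrite mulrBl divfK ?gt_eqF.
rewrite -powR_natX ge0_ler_powR ?nnegrE // ler_nat //.
Qed.

Theorem sixth_exponent_all (R : realType) kap (eps : R) :
  0 < eps -> sixth_exponent R kap eps.
Proof.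
move=> eps0; have [eps3|eps3] := leP eps 3; last first.
  exact: sixth_exponent_mono (ltW eps3) (sixth_exponent3 R kap).
pose dl := Num.min eps 1.
have dl0 : 0 < dl by rewrite lt_min eps0 ltr01.
have dl1 : dl <= 1 by rewrite ge_min lexx orbT.
have dle : dl <= eps by rewrite ge_min lexx.
pose n := (Num.truncn (22 / eps)).+1.
have ln : 22 <= eps * n%:R.
  by rewrite mulrC -ler_pdivrMr // ltW // Num.Theory.truncnS_gt.
pose h := dl / (2 ^+ n + 1).
have h0 : 0 < h by rewrite divr_gt0 // addr_gt0 // exprn_gt0.
(* The exponent is kept above [eps], so one [dl] and one [n] serve in every step and the decrement
   [h] stays fixed. *)
have step k : sixth_exponent R kap (Num.max eps (3 - k%:R * h)).
  elim: k => [|k IH].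
    rewrite mul0r subr0 max_r //; exact: sixth_exponent3.
  have le1 : Num.max eps (3 - k%:R * h) - h <= Num.max eps (3 - k.+1%:R * h).
    rewrite le_max -[k.+1%:R]natr1; case: (leP eps (3 - k%:R * h)) => _;
      apply/orP; [right|left]; lra.
  apply: sixth_exponent_mono le1 _; apply: sixth_exponent_step => //.
  - by rewrite le_max dle.
  - by rewrite ge_max eps3 /= gerBl mulr_ge0 // ltW.
  - by rewrite (le_trans ln) // ler_wpM2r // le_max lexx.
have := step (Num.truncn (3 / h)).+1; rewrite max_l //.
have : 3 / h < (Num.truncn (3 / h)).+1%:R by rewrite Num.Theory.truncnS_gt.
by rewrite ltr_pdivrMr //; lra.
Qed.

(** * Convex curves are transversal *)

Section UniformConvexity.
Context {R : realType}.
Variables (phi : nat -> R) (mu : R).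
Hypothesis mu0 : 0 < mu.
Hypothesis phi2 : forall n,
  mu <= (phi n.+2 - phi n.+1) - (phi n.+1 - phi n) <= 16 * mu.
Local Notation D k := (phi k.+1 - phi k).

Lemma slope_gap k i : i%:R * mu <= D (k + i) - D k <= i%:R * (16 * mu).
Proof.
elim: i => [|i /andP[h1 h2]]; first by rewrite addn0 subrr !mul0r lexx.
have /andP[h3 h4] := phi2 (k + i).
by rewrite addnS -natr1; apply/andP; split; lra.
Qed.

(** Discrete Taylor formula: the remainder sums the slope gaps, and [8 * mu * (i * (i + 1))] is
    [16 * mu] times a triangular number, a form shared with [tangent_left]. *)
Lemma tangent_right w i :
  0 <= phi (w + i) - phi w - i%:R * D w <= 8 * mu * (i%:R * i.+1%:R).
Proof.
elim: i => [|i /andP[h1 h2]]; first by rewrite addn0 subrr !(mul0r, mulr0) subr0 lexx.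
have /andP[h3 h4] := slope_gap w i.
have mu_gt0 := mu0; have i0 : 0 <= i%:R * mu by rewrite mulr_ge0 // ltW.
have e1 : i.+1%:R = i%:R + 1 :> R by rewrite natr1.
have e2 : i.+2%:R = i%:R + 2 :> R by rewrite -addn2 natrD.
rewrite e1 in h2; rewrite addnS e1 e2; apply/andP; split; first by lra.
by lra.
Qed.

Lemma tangent_left w i :
  0 <= phi w - phi (w + i) + i%:R * D (w + i) <= 8 * mu * (i%:R * i.+1%:R).
Proof.
elim: i w => [|i IH] w; first by rewrite addn0 subrr !(mul0r, mulr0) addr0 lexx.
have /andP[h1 h2] := IH w.+1; rewrite addSnnS in h1 h2.
have /andP[h3 h4] := slope_gap w i.+1.
have e1 : i.+1%:R = i%:R + 1 :> R by rewrite natr1.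
have e2 : i.+2%:R = i%:R + 2 :> R by rewrite -addn2 natrD.
have mu_gt0 := mu0; have i0 : 0 <= i%:R * mu by rewrite mulr_ge0 // ltW.
rewrite e1 in h3 h4; rewrite e1 e2; apply/andP; split; lra.
Qed.

Lemma tangent_error B w u : (u < w + B)%N -> (w < u + B)%N ->
  0 <= phi u - phi w - (u%:R - w%:R) * D w <= 8 * mu * B%:R ^+ 2.
Proof.
have mono i : (i < B)%N -> 8 * mu * (i%:R * i.+1%:R) <= 8 * mu * B%:R ^+ 2.
  move=> iB; rewrite ler_wpM2l ?mulr_ge0 ?(ltW mu0) // expr2.
  by rewrite ler_pM // ler_nat // ltnW.
move=> uw wu; have [le|/ltnW le] := leqP w u.
  have /andP[h1 h2] := tangent_right w (u - w).
  rewrite subnKC // natrB // in h1 h2.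
  by rewrite h1 (le_trans h2) // -natrB // mono //; lia.
have /andP[h1 h2] := tangent_left u (w - u).
rewrite subnKC // natrB // in h1 h2.
have -> : phi u - phi w - (u%:R - w%:R) * D w =
  phi u - phi w + (w%:R - u%:R) * D w by ring.
by rewrite h1 (le_trans h2) // -natrB // mono //; lia.
Qed.

Lemma chord_right w d p h : (w + d <= p)%N ->
  h%:R * (d%:R * mu) <= phi (p + h) - phi p - h%:R * D w.
Proof.
move=> wp; elim: h => [|h IH]; first by rewrite addn0 !mul0r subrr subr0.
have /andP[h1 _] := slope_gap w (p + h - w).
rewrite subnKC in h1; last by lia.
have : d%:R * mu <= (p + h - w)%:R * mu.
  by rewrite ler_wpM2r ?(ltW mu0) // ler_nat; lia.
by rewrite addnS -natr1; lra.
Qed.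

Lemma chord_left w d p h : (p + h + d <= w)%N ->
  phi (p + h) - phi p - h%:R * D w <= - (h%:R * (d%:R * mu)).
Proof.
elim: h => [|h IH] wp; first by rewrite addn0 !mul0r subrr subr0 oppr0.
have /andP[h1 _] := slope_gap (p + h) (w - (p + h)).
rewrite subnKC in h1; last by lia.
have : d%:R * mu <= (w - (p + h))%:R * mu.
  by rewrite ler_wpM2r ?(ltW mu0) // ler_nat; lia.
have := IH (ltac:(lia)); rewrite addnS -natr1; lra.
Qed.

(** Subtract the tangent at [w] from the second equation by means of the first. The [u]s and [v]s
    lie within [8 * mu * B^2] of the tangent, so they contribute at most [16 * mu * B^2], and the
    six floors at most 3. The chord from [p] to [n] lies at distance [d], so its slope differs from
    that of the tangent by at least [d * mu]. *)
Lemma transversal_pair (psi : nat -> nat) d B w n p u1 v1 u2 v2 :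
  let us := [:: u1; v1; u2; v2] in
  3 <= mu -> (0 < B)%N ->
  (forall k, k \in [:: n, p & us] -> (psi k)%:R <= phi k < (psi k)%:R + 1) ->
  (forall u, u \in us -> (u < w + B)%N /\ (w < u + B)%N) ->
  (w + d <= n /\ w + d <= p)%N \/ (n + d <= w /\ p + d <= w)%N ->
  (n + u1 + u2 = p + v1 + v2)%N ->
  (psi n + psi u1 + psi u2 = psi p + psi v1 + psi v2)%N ->
  (d * (n - p + (p - n)) <= 17 * B ^ 2)%N.
Proof.
move=> us mu3 B0; rewrite /us {us}.
wlog np : n p u1 v1 u2 v2 / (p <= n)%N.
  move=> H; have [np|/ltnW np] := leqP p n; first exact: H.
  move=> hpsi hus sep e1 e2; rewrite [(n - p + _)%N]addnC.
  apply: (H p n v1 u1 v2 u2) => //.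
  - by move=> k hk; apply: hpsi; move: hk; rewrite !inE => /orP[|/orP[|/or4P[]]] /eqP ->;
      rewrite eqxx ?orbT.
  - by move=> k hk; apply: hus; move: hk; rewrite !inE => /or4P[] /eqP ->;
      rewrite eqxx ?orbT.
  - by case: sep => -[]; [left|right].
move=> hpsi hus sep e1 e2; have -> : (p - n = 0)%N by lia.
rewrite addn0; set h := (n - p)%N.
have nE : n = (p + h)%N by rewrite /h; lia.
have e3 : (h + u1 + u2 = v1 + v2)%N by rewrite /h; clear -e1 np; lia.
have f1 : h%:R = v1%:R + v2%:R - u1%:R - u2%:R :> R.
  by rewrite -natrD -e3 !natrD addrAC !addrK.
have f2 : (psi n)%:R + (psi u1)%:R + (psi u2)%:R =
    (psi p)%:R + (psi v1)%:R + (psi v2)%:R :> R by rewrite -!natrD e2.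
have T u : u \in [:: u1; v1; u2; v2] ->
    0 <= phi u - phi w - (u%:R - w%:R) * D w <= 8 * mu * B%:R ^+ 2.
  by move=> /hus[a b]; apply: tangent_error.
have /andP[a1 b1] := T u1 (mem_head _ _).
have /andP[a2 b2] : 0 <= phi v1 - phi w - (v1%:R - w%:R) * D w <= 8 * mu * B%:R ^+ 2.
  by apply: T; rewrite !inE eqxx orbT.
have /andP[a3 b3] : 0 <= phi u2 - phi w - (u2%:R - w%:R) * D w <= 8 * mu * B%:R ^+ 2.
  by apply: T; rewrite !inE eqxx !orbT.
have /andP[a4 b4] : 0 <= phi v2 - phi w - (v2%:R - w%:R) * D w <= 8 * mu * B%:R ^+ 2.
  by apply: T; rewrite !inE eqxx !orbT.
have P k : k \in [:: n; p; u1; v1; u2; v2] -> (psi k)%:R <= phi k < (psi k)%:R + 1.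
  exact: hpsi.
have /andP[c1 d1] : (psi n)%:R <= phi n < (psi n)%:R + 1 by apply: P; rewrite !inE eqxx.
have /andP[c2 d2] : (psi p)%:R <= phi p < (psi p)%:R + 1 by apply: P; rewrite !inE eqxx ?orbT.
have /andP[c3 d3] : (psi u1)%:R <= phi u1 < (psi u1)%:R + 1 by apply: P; rewrite !inE eqxx ?orbT.
have /andP[c4 d4] : (psi v1)%:R <= phi v1 < (psi v1)%:R + 1 by apply: P; rewrite !inE eqxx ?orbT.
have /andP[c5 d5] : (psi u2)%:R <= phi u2 < (psi u2)%:R + 1 by apply: P; rewrite !inE eqxx ?orbT.
have /andP[c6 d6] : (psi v2)%:R <= phi v2 < (psi v2)%:R + 1 by apply: P; rewrite !inE eqxx ?orbT.
have g : h%:R * (d%:R * mu) <= `|phi n - phi p - h%:R * D w|.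
  rewrite nE; case: sep => -[s1 s2].
    by rewrite (le_trans _ (ler_norm _)) // chord_right.
  by rewrite -normrN (le_trans _ (ler_norm _)) // lerNr chord_left // -nE.
have g2 : `|phi n - phi p - h%:R * D w| <= 16 * mu * B%:R ^+ 2 + 3.
  rewrite ler_norml f1; apply/andP; split; lra.
have B1 : 1 <= B%:R ^+ 2 :> R by rewrite -natrX ler1n expn_gt0 B0.
have : h%:R * d%:R <= 17 * B%:R ^+ 2 :> R.
  (* As 3 <= mu <= mu B^2, the rounding error is absorbed by raising 16 to 17. *)
  rewrite -(ler_pM2r mu0); have : mu <= mu * B%:R ^+ 2 by rewrite ler_peMr // ltW.
  by lra.
by rewrite -natrX -!natrM ler_nat mulnC.
Qed.

End UniformConvexity.

Section Extension.
Context {R : realType}.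

(** Past the last index the sequence continues as a quadratic with the last slope and second
    difference [mu]. The convexity lemmas can then be stated for all indices. *)
Lemma convex_extension (N : nat) (phi : nat -> R) (mu : R) : 0 < mu ->
  (forall n, (n.+2 < N)%N ->
    mu <= (phi n.+2 - phi n.+1) - (phi n.+1 - phi n) <= 16 * mu) ->
  exists2 phi' : nat -> R, (forall n, (n < N)%N -> phi' n = phi n) &
  forall n, mu <= (phi' n.+2 - phi' n.+1) - (phi' n.+1 - phi' n) <= 16 * mu.
Proof.
move=> mu0 h.
pose tail (n : nat) : R := let t := (n - N.-1)%N in
  phi N.-1 + t%:R * (phi N.-1 - phi N.-2) + mu * (t%:R * (t%:R + 1)) / 2.
exists (fun n => if (n < N)%N then phi n else tail n) => [n -> //|n].
have tE k : tail (N.-1 + k)%N =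
    phi N.-1 + k%:R * (phi N.-1 - phi N.-2) + mu * (k%:R * (k%:R + 1)) / 2.
  by rewrite /tail addKn.
have [nN|nN] := ltnP n.+2 N.
  by rewrite (ltnW nN) (ltnW (ltnW nN)) h.
have [nN1|nN1] := ltnP n.+1 N.
  have eN : N = n.+2 by apply/eqP; rewrite eqn_leq nN nN1.
  rewrite (ltnW nN1) [in tail _](_ : n.+2 = N.-1 + 1)%N; last by rewrite eN addn1.
  by rewrite tE eN /=; apply/andP; split; lra.
have [nN2|nN2] := ltnP n N.
  have eN : N = n.+1 by apply/eqP; rewrite eqn_leq nN1 nN2.
  rewrite (_ : n.+2 = N.-1 + 2)%N; last by rewrite eN addn2.
  rewrite (_ : n.+1 = N.-1 + 1)%N; last by rewrite eN addn1.
  by rewrite !tE eN /=; apply/andP; split; lra.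
have /subnKC <- : (N.-1 <= n)%N by lia.
by rewrite -!addnS !tE -[(_ - _).+2%:R]natr1 -natr1; apply/andP; split; lra.
Qed.

End Extension.

(** * Characters of finite cyclic groups *)

Section Characters.
Context {R : realType}.

Definition cis (t : R) : R[i] := (cos t +i* sin t)%C.

Lemma cis0 : cis 0 = 1.
Proof. by rewrite /cis cos0 sin0. Qed.

Lemma cisD s t : cis (s + t) = cis s * cis t.
Proof. by apply/eqP; rewrite eq_complex /= cosD sinD [cos s * sin t + _]addrC !eqxx. Qed.

Lemma cisN t : (cis t)^*%C = cis (- t).
Proof. by rewrite /cis cosN sinN. Qed.

Lemma cisX t n : cis t ^+ n = cis (n%:R * t).
Proof.
elim: n => [|n IH]; first by rewrite mul0r cis0.
by rewrite exprS IH -cisD -natr1 mulrDl mul1r addrC.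
Qed.

Lemma sqn_cis t : sqn (cis t) = 1.
Proof. by rewrite /sqn /= cos2Dsin2. Qed.

Lemma cis_prim P : (0 < P)%N -> P.-primitive_root (cis (2 * pi / P%:R)).
Proof.
move=> P0; rewrite /primitive_root_of_unity P0; apply/forallP => k.
rewrite unity_rootE cisX; apply/eqP.
have PR : P%:R != 0 :> R by rewrite pnatr_eq0 -lt0n.
have [->|kP] := eqVneq k.+1 P.
  rewrite mulrCA divff // mulr1 /cis mulr_natl cos2pi sin2pi.
  by rewrite eqxx.
apply/negbTE/eqP => /(congr1 (@complex.Re R)) /=.
(* The half angle lies strictly between 0 and pi, where the sine is positive, so the cosine of the
   double angle is not 1. *)
set y : R := pi * (k.+1%:R / P%:R).
have -> : k.+1%:R * (2 * pi / P%:R) = y *+ 2 by rewrite /y; field.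
have yp : 0 < y < pi.
  rewrite /y mulr_gt0 ?pi_gt0 ?divr_gt0 ?ltr0n //= gtr_pMr ?pi_gt0 //.
  by rewrite ltr_pdivrMr ?ltr0n // mul1r ltr_nat ltn_neqAle kP ltn_ord.
have := sin_gt0_pi yp; rewrite cos_mulr2n => s0 c1.
have := cos2Dsin2 y; nra.
Qed.

(** A geometric sum whose ratio [zeta] is a [P]-th root of unity; the ratio is not 1 because [A] and
    [B] are distinct residues. *)
Lemma sum_cis_eq0 P A B : (0 < P)%N -> (A < P)%N -> (B < P)%N -> A != B ->
  \sum_(i < P) cis (2 * pi * (i%:R * A%:R / P%:R)) *
    (cis (2 * pi * (i%:R * B%:R / P%:R)))^*%C = 0.
Proof.
move=> P0 AP BP AB; have prim := cis_prim P P0.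
set z := cis (2 * pi / P%:R) in prim.
have zE k : cis (2 * pi * k%:R / P%:R) = z ^+ k.
  by rewrite /z cisX; congr cis; ring.
pose zeta := z ^+ A * (z ^+ B)^*%C.
rewrite (eq_bigr (fun i : 'I_P => zeta ^+ i)); last first.
  move=> i _; rewrite /zeta exprMn -rmorphXn /= /z !cisX.
  by congr (cis _ * (cis _)^*%C); ring.
have zJ : z ^+ B * (z ^+ B)^*%C = 1 by rewrite /z cisX cisN -cisD subrr cis0.
have : (zeta - 1) * \sum_(i < P) zeta ^+ i = 0.
  rewrite -subrX1 /zeta exprMn -rmorphXn /= -!exprM ![(_ * P)%N]mulnC !exprM.
  by rewrite (prim_expr_order prim) !expr1n rmorph1 mulr1 subrr.
move/eqP; rewrite mulf_eq0 subr_eq0 => /orP[/eqP z1|/eqP //].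
case/negP: AB; rewrite -(modn_small AP) -(modn_small BP).
rewrite -(eq_prim_root_expr prim) -[z ^+ B]mul1r -z1 /zeta -mulrA.
by rewrite [(z ^+ B)^*%C * _]mulrC zJ mulr1.
Qed.

End Characters.

Section Grid.
Context {R : realType}.
Variables (N P1 P2 : nat) (phi : nat -> R) (psi : nat -> nat) (mu : R).

(** The character of Z/P1 x Z/P2 attached to the point (n, psi n) of the rounded curve. *)
Definition grid_char (n : nat) (x : 'I_P1 * 'I_P2) : R[i] :=
  cis (2 * pi * (x.1%:R * n%:R / P1%:R + x.2%:R * (psi n)%:R / P2%:R)).

Lemma sqn_grid_char n x : sqn (grid_char n x) = 1.
Proof. exact: sqn_cis. Qed.

Lemma sextic_grid n m u1 v1 u2 v2 :
  sextic [the finType of ('I_P1 * 'I_P2)%type] grid_char n m u1 v1 u2 v2 =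
  (\sum_(i < P1) cis (2 * pi * (i%:R * (n + u1 + u2)%:R / P1%:R)) *
    (cis (2 * pi * (i%:R * (m + v1 + v2)%:R / P1%:R)))^*%C) *
  (\sum_(k < P2) cis (2 * pi * (k%:R * (psi n + psi u1 + psi u2)%:R / P2%:R)) *
    (cis (2 * pi * (k%:R * (psi m + psi v1 + psi v2)%:R / P2%:R)))^*%C).
Proof.
rewrite big_distrlr pair_bigA /sextic; apply: eq_bigr => -[i k] _ /=.
have J t : (cos t -i* sin t)%C = cis (- t) by exact: cisN.
by rewrite /grid_char /= !J -!cisD; congr cis; rewrite !natrD; ring.
Qed.

Hypothesis mu3 : 3 <= mu.
Hypothesis NP1 : (3 * N <= P1)%N.
Hypothesis psiP2 : forall n, (n < N)%N -> (3 * psi n < P2)%N.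
Hypothesis psi_floor : forall n, (n < N)%N -> (psi n)%:R <= phi n < (psi n)%:R + 1.
Hypothesis phi2 : forall n, (n.+2 < N)%N ->
    mu <= (phi n.+2 - phi n.+1) - (phi n.+1 - phi n) <= 16 * mu.

(** The bounds on [P1] and [P2] exclude wrap-around in sums of three frequencies. A nonzero [sextic]
    therefore forces both equations in the integers, and [transversal_pair] applies with the tangent
    at [u1]. *)
Lemma grid_transversality :
  transversality N [the finType of ('I_P1 * 'I_P2)%type] grid_char 17.
Proof.
move=> d B s n m u1 v1 u2 v2 us d0 nN mN hus sep big.
have uN1 : (u1 < N)%N by have [] := hus u1 (mem_head _ _).
have vN1 : (v1 < N)%N by have [] := hus v1; rewrite ?inE ?eqxx ?orbT.
have uN2 : (u2 < N)%N by have [] := hus u2; rewrite ?inE ?eqxx ?orbT.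
have vN2 : (v2 < N)%N by have [] := hus v2; rewrite ?inE ?eqxx ?orbT.
rewrite sextic_grid.
have [e1|ne1] := eqVneq (n + u1 + u2)%N (m + v1 + v2)%N; last first.
  by rewrite sum_cis_eq0 ?mul0r //; lia.
have := psiP2 n nN; have := psiP2 m mN; have := psiP2 u1 uN1.
have := psiP2 u2 uN2; have := psiP2 v1 vN1; have := psiP2 v2 vN2.
move=> q1 q2 q3 q4 q5 q6.
have [e2|ne2] := eqVneq (psi n + psi u1 + psi u2)%N (psi m + psi v1 + psi v2)%N;
  last by rewrite [X in _ * X]sum_cis_eq0 ?mulr0 //; lia.
have mu0 : 0 < mu by exact: lt_le_trans mu3.
have [phi' phiE phi2'] := convex_extension N phi mu mu0 phi2.
have B0 : (0 < B)%N by have [_] := hus u1 (mem_head _ _); lia.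
suff : (d * (n - m + (m - n)) <= 17 * B ^ 2)%N by rewrite leqNgt big.
apply: (transversal_pair phi' mu mu0 phi2' psi d B u1 n m u1 v1 u2 v2) => //.
- have kN k : k \in [:: n, m & us] -> (k < N)%N.
    by rewrite !inE => /orP[|/orP[|/or4P[]]] /eqP ->.
  by move=> k /kN kN'; rewrite phiE // psi_floor.
- move=> u /hus[_ h]; have [_ h1] := hus u1 (mem_head _ _); lia.
- by case: sep => /(_ u1 (mem_head _ _)); [right|left].
Qed.

End Grid.

(** * From the grid to the maximal function *)

Section Absorption.
Local Open Scope classical_set_scope.
Local Open Scope ring_scope.
Context {R : realType}.
Implicit Types c : nat -> R[i].

(** The derivative in the parameter is a sum of the same shape with new coefficients, so
    perturbation errors remain in the class of sums being estimated. Real parts are used because the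
    mean value theorem is real. *)
Lemma trig_mvt (N : nat) (p q al be : nat -> R) (u v : R) : u <= v ->
  exists2 w, u <= w <= v &
  \sum_(n < N) (p n * cos (al n + v * be n) - q n * sin (al n + v * be n)) -
  \sum_(n < N) (p n * cos (al n + u * be n) - q n * sin (al n + u * be n)) =
  (\sum_(n < N) (- (be n * q n) * cos (al n + w * be n) -
     be n * p n * sin (al n + w * be n))) * (v - u).
Proof.
move=> uv.
pose h (n : 'I_N) : R -> R :=
  fun w => p n * cos (al n + w * be n) - q n * sin (al n + w * be n).
pose h' (w : R) (n : 'I_N) : R := - (be n * q n) * cos (al n + w * be n) -
     be n * p n * sin (al n + w * be n).
have hd (w : R) (n : 'I_N) : is_derive w (1 : R) (h n) (h' w n).
  rewrite /h /h'; apply: is_derive_eq.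
  rewrite /GRing.scale /=; ring.
have hs (w : R) : is_derive w (1 : R) (\sum_(n < N) h n) (\sum_(n < N) h' w n).
  exact: is_derive_sum.
have cont : {within `[u, v]%classic, continuous (\sum_(n < N) h n)}.
  apply: derivable_within_continuous => w _; exact: ex_derive.
have [w /andP[w1 w2]] := MVT_segment uv (fun w _ => hs w) cont.
rewrite !fct_sumE => e; exists w; last exact: e.
by rewrite !bnd_simp in w1 w2; rewrite w1.
Qed.

Lemma pow6D_le (u v : R) : (u + v) ^+ 6 <= 32 * (u ^+ 6 + v ^+ 6).
Proof.
have h : (u + v) ^+ 2 <= 2 * (u ^+ 2 + v ^+ 2).
  rewrite -subr_ge0 (_ : _ - _ = (u - v) ^+ 2) ?sqr_ge0 //; ring.
rewrite [leLHS](_ : _ = ((u + v) ^+ 2) ^+ 3); last by rewrite -exprM.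
apply: (@le_trans _ _ ((2 * (u ^+ 2 + v ^+ 2)) ^+ 3)).
  by rewrite lerXn2r ?nnegrE ?sqr_ge0 // mulr_ge0 // addr_ge0 ?sqr_ge0.
rewrite -subr_ge0 (_ : _ - _ =
  24 * ((u ^+ 2 + v ^+ 2) * (u ^+ 2 - v ^+ 2) ^+ 2)); last by ring.
by rewrite mulr_ge0 // mulr_ge0 ?sqr_ge0 // addr_ge0 ?sqr_ge0.
Qed.

Lemma pow6D4_le (u v w z : R) :
  (u + v + w + z) ^+ 6 <= 1024 * (u ^+ 6 + v ^+ 6 + w ^+ 6 + z ^+ 6).
Proof.
have h := pow6D_le (u + v) (w + z); rewrite addrA in h.
apply: (le_trans h); rewrite (_ : 1024 = 32 * 32); last by rewrite -natrM.
rewrite -mulrA ler_wpM2l // -addrA mulrDr.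
by rewrite lerD ?pow6D_le.
Qed.

Lemma pow6_perturb (u e1 e2 e3 d1 d2 d3 : R) :
  e1 ^+ 6 <= d1 -> e2 ^+ 6 <= d2 -> e3 ^+ 6 <= d3 ->
  (u + e1 + e2 + e3) ^+ 6 <= 1024 * (u ^+ 6 + d1 + d2 + d3).
Proof.
move=> h1 h2 h3; apply: le_trans (pow6D4_le u e1 e2 e3) _.
apply: ler_wpM2l; first exact: ler0n.
by apply: lerD => //; apply: lerD => //; apply: lerD.
Qed.

(** Since 1024 / 5^6 < 1/6, the three error terms together cost at most half of [v]. *)
Lemma absorption_arith (g a b d e v : R) :
  a <= g -> b <= v -> d <= v -> e <= v -> 0 <= v ->
  1024 * (a + 5^-1 ^+ 6 * b + 5^-1 ^+ 6 * d + 5^-1 ^+ 6 * e) <=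
  1024 * g + v / 2.
Proof.
have e5 : 5^-1 ^+ 6 * 15625 = 1 :> R by field.
have : 0 <= 5^-1 ^+ 6 :> R by rewrite exprn_ge0 // invr_ge0.
move: (5^-1 ^+ 6) e5 => q e5 q0 ag bv dv ev v0.
have hq : 1024 * q <= 6^-1 by lra.
have := ler_wpM2r v0 hq; have := ler_wpM2l q0 bv.
have := ler_wpM2l q0 dv; have := ler_wpM2l q0 ev; lra.
Qed.

Lemma half_absorb (g v : R) : v <= 1024 * g + v / 2 -> v <= 2048 * g.
Proof. lra. Qed.

Variable N : nat.
Local Notation mass := (l2mass N).

Definition wave c (th : nat -> R) : R :=
  \sum_(n < N) (complex.Re (c n) * cos (2 * pi * th n) -
                complex.Im (c n) * sin (2 * pi * th n)).

(** The coefficients of the derivative, up to the factor [2 * pi * K]. Dividing by a bound [K] for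
    the frequencies keeps the mass from growing. *)
Definition rotate (be : nat -> R) (K : R) c : nat -> R[i] :=
  fun n => c n * (0 +i* (be n / K))%C.

Lemma waveE c th : wave c th = complex.Re (\sum_(n < N) c n * cis (2 * pi * th n)).
Proof.
rewrite raddf_sum; apply: eq_bigr => n _.
by case: (c n) => p q.
Qed.

Lemma wave_sqr_le c th : wave c th ^+ 2 <= N%:R * mass c.
Proof.
apply: (le_trans (sqr_sum_le _ _)); rewrite ler_wpM2l //; apply: ler_sum => n _.
set p := complex.Re _; set q := complex.Im _; set C := cos _; set S := sin _.
have e : C ^+ 2 + S ^+ 2 = 1 by rewrite cos2Dsin2.
rewrite /sqn -/p -/q -[leRHS]mulr1 -e -subr_ge0.
by rewrite (_ : _ - _ = (p * S + q * C) ^+ 2) ?sqr_ge0 //; ring.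
Qed.

Lemma mass_rotate be K c : 0 < K -> (forall n, (n < N)%N -> `|be n| <= K) ->
  mass (rotate be K c) <= mass c.
Proof.
move=> K0 hb; apply: ler_sum => n _; rewrite sqnM -[leRHS]mulr1.
rewrite ler_wpM2l ?sqn_ge0 // /sqn /= expr0n add0r -real_normK ?num_real // expr_le1 //.
by rewrite normrM normfV (gtr0_norm K0) ler_pdivrMr // mul1r hb.
Qed.

Lemma wave_mvt c th be K u v : 0 < K -> u <= v ->
  exists2 w, u <= w <= v &
  wave c (fun n => th n + v * be n) = wave c (fun n => th n + u * be n) +
    (v - u) * (2 * pi * K) * wave (rotate be K c) (fun n => th n + w * be n).
Proof.
move=> K0 uv.
have [w wuv e] := trig_mvt N (fun n => complex.Re (c n)) (fun n => complex.Im (c n))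
  (fun n => 2 * pi * th n) (fun n => 2 * pi * be n) u v uv.
have D y n : 2 * pi * th n + y * (2 * pi * be n) = 2 * pi * (th n + y * be n).
  by ring.
exists w => //; rewrite addrC; apply/eqP; rewrite -subr_eq; apply/eqP.
under [X in wave c (fun _ => _ + v * _) - X]eq_bigr do rewrite -D.
rewrite {1}/wave; under [X in X - _]eq_bigr do rewrite -D.
rewrite e mulrC -mulrA; congr (_ * _); rewrite mulr_sumr; apply: eq_bigr => n _.
rewrite -D /rotate; case: (c n) => p q /=.
by field; rewrite gt_eqF.
Qed.

End Absorption.

Section GridMaximal.
Local Open Scope classical_set_scope.
Local Open Scope ring_scope.
Context {R : realType}.
Variables (N : nat) (phi : nat -> R) (psi : nat -> nat).
Hypothesis N0 : (0 < N)%N.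
Hypothesis psi_floor : forall n, (n < N)%N -> (psi n)%:R <= phi n < (psi n)%:R + 1.
Hypothesis phi_le : forall n, (n < N)%N -> phi n <= 640 * N%:R ^+ 2.
Local Notation mass := (l2mass N).
Local Notation wave := (wave N).
Local Notation P1 := (160 * N)%N.
Local Notation P2 := (25600 * N ^ 2)%N.
Implicit Types c : nat -> R[i].

Definition freq_x (n : nat) : R := n%:R / N%:R.
Definition freq_t (n : nat) : R := (psi n)%:R / (160 * N%:R ^+ 2).
(** The part of the frequency lost by rounding. It receives its own small variable [s], so that at
    [s = 0] only the rounded frequencies remain. *)
Definition freq_s (n : nat) : R := phi n - (psi n)%:R.
Definition phase3 (x t s : R) (n : nat) : R :=
  x * freq_x n + t * freq_t n + s * freq_s n.
Definition cell (j : nat) (x t s : R) :=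
  [/\ j%:R <= x <= j%:R + 1, 0 <= t <= N%:R ^+ 2 & 0 <= s <= 160^-1].

Lemma freq_x_le n : (n < N)%N -> `|freq_x n| <= 1.
Proof.
move=> nN; rewrite ger0_norm ?divr_ge0 // ler_pdivrMr ?ltr0n // mul1r ler_nat.
exact: ltnW.
Qed.

Lemma freq_t_le n : (n < N)%N -> `|freq_t n| <= 4.
Proof.
move=> nN; rewrite ger0_norm ?divr_ge0 ?mulr_ge0 ?exprn_ge0 //.
rewrite ler_pdivrMr ?mulr_gt0 ?exprn_gt0 ?ltr0n //.
have /andP[h _] := psi_floor n nN; rewrite (le_trans h) //.
by rewrite (le_trans (phi_le n nN)) //; lra.
Qed.

Lemma freq_s_le n : (n < N)%N -> `|freq_s n| <= 1.
Proof.
move=> nN; have /andP[h1 h2] := psi_floor n nN.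
by rewrite ger0_norm /freq_s; lra.
Qed.

(** Since 2 pi < 8, a displacement with [d * K <= 1/40] produces a factor at most 1/5. *)
Lemma pow6_error (d K w : R) : 0 <= d -> d * K <= 40^-1 -> 0 < K ->
  (d * (2 * pi * K) * w) ^+ 6 <= 5^-1 ^+ 6 * w ^+ 6.
Proof.
move=> d0 dK K0; rewrite exprMn ler_wpM2r ?exprn_even_ge0 //.
have pi0 := pi_gt0 R; have pi2 : pi / 2 < 2 :> R := pihalf_lt2 R.
have e : d * (2 * pi * K) = d * K * (2 * pi) by ring.
have dK0 : 0 <= d * K by rewrite mulr_ge0 // ltW.
have h1 : d * K * (2 * pi) <= 40^-1 * (2 * pi).
  by rewrite ler_wpM2r // mulr_ge0 // ltW.
have h2 : d * K * (2 * pi) <= 5^-1 by apply: (le_trans h1); lra.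
have h3 : 0 <= d * K * (2 * pi) by rewrite mulr_ge0 // mulr_ge0 // ltW.
by rewrite e lerXn2r ?nnegrE.
Qed.

Lemma cell_grid_point j x t s : cell j x t s -> exists i k : nat,
  [/\ (160 * j <= i < 160 * j.+1)%N, (k <= 160 * N ^ 2)%N,
      j%:R <= i%:R / 160 :> R, i%:R / 160 <= x <= i%:R / 160 + 160^-1 &
      k%:R / 160 <= t <= k%:R / 160 + 160^-1].
Proof.
move=> [/andP[x1 x2] /andP[t1 t2] _].
pose u := 160 * (x - j%:R); have u0 : 0 <= u by rewrite mulr_ge0 // subr_ge0.
(* The cap at 159 keeps the endpoint x = j + 1 in cell [j], so distinct cells use distinct grid
   points. *)
pose m := Num.truncn u; pose r := minn 159 m.
have /andP[m1 m2] : m%:R <= u < m.+1%:R := truncn_itv u0.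
have ru : r%:R <= u by rewrite (le_trans _ m1) // ler_nat geq_minr.
have ur : u <= r%:R + 1.
  rewrite natr1 /r; have [h|h] := leqP m 159.
    exact: ltW.
  by rewrite /u; lra.
have t0 : 0 <= 160 * t by rewrite mulr_ge0.
have /andP[k1 k2] : _ <= 160 * t < _ := truncn_itv t0.
exists (160 * j + r)%N, (Num.truncn (160 * t)).
have r159 : (r <= 159)%N by rewrite geq_minl.
set k := Num.truncn (160 * t) in k1 k2 *.
rewrite -[k.+1%:R]natr1 in k2; rewrite natrD natrM; split.
- by rewrite leq_addr /= mulnS addnC ltn_add2r.
- by rewrite -(ler_nat R) natrM natrX (le_trans k1) // ler_wpM2l.
- by rewrite ler_pdivlMr // mulrC lerDl.
- by rewrite /u in ru ur; apply/andP; split; lra.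
- by apply/andP; split; lra.
Qed.

(** The coordinates [x], [t], [s] are moved to the grid one at a time. Each intermediate point stays
    in the cell, which makes the error terms admissible for the absorption. *)
Lemma wave_cell c j x t s : cell j x t s ->
  exists (i k : nat) (x' t' s' : R),
  [/\ (160 * j <= i < 160 * j.+1)%N, (k <= 160 * N ^ 2)%N,
      cell j x' t s, cell j (i%:R / 160) t' s /\ cell j (i%:R / 160) (k%:R / 160) s' &
  wave c (phase3 x t s) ^+ 6 <= 1024 *
   (wave c (phase3 (i%:R / 160) (k%:R / 160) 0) ^+ 6 +
    5^-1 ^+ 6 * wave (rotate freq_x 1 c) (phase3 x' t s) ^+ 6 +
    5^-1 ^+ 6 * wave (rotate freq_t 4 c) (phase3 (i%:R / 160) t' s) ^+ 6 +
    5^-1 ^+ 6 * wave (rotate freq_s 1 c) (phase3 (i%:R / 160) (k%:R / 160) s') ^+ 6)].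
Proof.
move=> cl; have [i [k [hi hk ji /andP[x1 x2] /andP[t1 t2]]]] := cell_grid_point j x t s cl.
case: cl => /andP[jx xj] /andP[t0 tN] /andP[s0 s1].
set xi := i%:R / 160 in ji x1 x2 *; set tk := k%:R / 160 in t1 t2 *.
have tk0 : 0 <= tk by rewrite divr_ge0.
have [x' /andP[x'1 x'2] ex] := wave_mvt N c
  (fun n => t * freq_t n + s * freq_s n) freq_x 1 xi x ltr01 x1.
have [t' /andP[t'1 t'2] et] := wave_mvt N c
  (fun n => xi * freq_x n + s * freq_s n) freq_t 4 tk t (ltr0n _ 4) t1.
have [s' /andP[s'1 s'2] es] := wave_mvt N c
  (fun n => xi * freq_x n + tk * freq_t n) freq_s 1 0 s ltr01 s0.
have Ex c' y : wave c' (fun n => t * freq_t n + s * freq_s n + y * freq_x n) =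
    wave c' (phase3 y t s).
  by congr (wave c' _); apply/funext => n; rewrite /phase3; ring.
have Et c' y : wave c' (fun n => xi * freq_x n + s * freq_s n + y * freq_t n) =
    wave c' (phase3 xi y s).
  by congr (wave c' _); apply/funext => n; rewrite /phase3; ring.
have Es c' y : wave c' (fun n => xi * freq_x n + tk * freq_t n + y * freq_s n) =
    wave c' (phase3 xi tk y) by [].
rewrite !Ex in ex; rewrite !Et in et; rewrite !Es subr0 in es.
exists i, k, x', t', s'; rewrite -/xi -/tk.
have xij : xi <= j%:R + 1 := le_trans x1 xj.
split => //.
- by clear ex et es; split; apply/andP; split => //; lra.
- by clear ex et es; split; split; apply/andP; split => //; lra.
rewrite ex et es [X in X ^+ 6](_ : _ = wave c (phase3 xi tk 0) +
  (x - xi) * (2 * pi * 1) * wave (rotate freq_x 1 c) (phase3 x' t s) +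
  (t - tk) * (2 * pi * 4) * wave (rotate freq_t 4 c) (phase3 xi t' s) +
  s * (2 * pi * 1) * wave (rotate freq_s 1 c) (phase3 xi tk s')); last first.
  by ring.
clear ex et es; apply: pow6_perturb; apply: pow6_error => //; lra.
Qed.

Definition grid_bound (W g : R) := forall c (i k : 'I_N -> nat), mass c <= W ->
  (forall j : 'I_N, 160 * j <= i j < 160 * j.+1)%N -> (forall j, k j <= 160 * N ^ 2)%N ->
  \sum_j wave c (phase3 ((i j)%:R / 160) ((k j)%:R / 160) 0) ^+ 6 <= g.

(** Take the supremum over all coefficients of mass at most [W] and all sample points. By
    [wave_cell] it is at most [1024 * g] plus half of itself. *)
Lemma grid_absorption W g : grid_bound W g ->
  forall c (x t s : 'I_N -> R), mass c <= W -> (forall j : 'I_N, cell j (x j) (t j) (s j)) ->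
  \sum_j wave c (phase3 (x j) (t j) (s j)) ^+ 6 <= 2048 * g.
Proof.
move=> hg c0 x0 t0 s0 c0W cl0.
pose S : set R := [set v | exists c (x t s : 'I_N -> R), [/\ mass c <= W,
  forall j : 'I_N, cell j (x j) (t j) (s j) &
  v = \sum_j wave c (phase3 (x j) (t j) (s j)) ^+ 6]].
(* Finiteness, from the trivial bound, is what permits subtracting half of the supremum. *)
have Sub : has_ubound S.
  exists (\sum_(j < N) (N%:R * W) ^+ 3) => v [c [x [t [s [cW _ ->]]]]].
  apply: ler_sum => j _; rewrite [leLHS](_ : _ = (wave c (phase3 (x j) (t j) (s j)) ^+ 2) ^+ 3).
    have h := wave_sqr_le N c (phase3 (x j) (t j) (s j)).
    have h2 : N%:R * mass c <= N%:R * W by rewrite ler_wpM2l.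
    rewrite lerXn2r ?nnegrE ?sqr_ge0 ?(le_trans h) //.
    by rewrite (le_trans _ h2) // mulr_ge0 // mass_ge0.
  by rewrite -exprM.
have S0 : S !=set0 by eexists; exists c0, x0, t0, s0; split.
have le_sup v : S v -> v <= sup S by move=> Sv; apply: ub_le_sup.
have half : sup S <= 1024 * g + sup S / 2.
  apply: ge_sup => // v [c [x [t [s [cW cl ->]]]]].
  have /choice[p hp] : forall j : 'I_N, exists p : nat * nat * R * R * R,
    let: (i, k, x', t', s') := p in
    [/\ (160 * j <= i < 160 * j.+1)%N, (k <= 160 * N ^ 2)%N,
      cell j x' (t j) (s j),
      cell j (i%:R / 160) t' (s j) /\ cell j (i%:R / 160) (k%:R / 160) s' &
    wave c (phase3 (x j) (t j) (s j)) ^+ 6 <= 1024 *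
    (wave c (phase3 (i%:R / 160) (k%:R / 160) 0) ^+ 6 +
    5^-1 ^+ 6 * wave (rotate freq_x 1 c) (phase3 x' (t j) (s j)) ^+ 6 +
    5^-1 ^+ 6 * wave (rotate freq_t 4 c) (phase3 (i%:R / 160) t' (s j)) ^+ 6 +
    5^-1 ^+ 6 * wave (rotate freq_s 1 c) (phase3 (i%:R / 160) (k%:R / 160) s') ^+ 6)].
    move=> j; have [i [k [x' [t' [s' h]]]]] := wave_cell c j _ _ _ (cl j).
    by exists (i, k, x', t', s').
  pose i j := (p j).1.1.1.1; pose k j := (p j).1.1.1.2.
  pose x' j := (p j).1.1.2; pose t' j := (p j).1.2; pose s' j := (p j).2.
  have {}hp (j : 'I_N) : [/\ (160 * j <= i j < 160 * j.+1)%N, (k j <= 160 * N ^ 2)%N,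
      cell j (x' j) (t j) (s j),
      cell j ((i j)%:R / 160) (t' j) (s j) /\ cell j ((i j)%:R / 160) ((k j)%:R / 160) (s' j) &
    wave c (phase3 (x j) (t j) (s j)) ^+ 6 <= 1024 *
    (wave c (phase3 ((i j)%:R / 160) ((k j)%:R / 160) 0) ^+ 6 +
    5^-1 ^+ 6 * wave (rotate freq_x 1 c) (phase3 (x' j) (t j) (s j)) ^+ 6 +
    5^-1 ^+ 6 * wave (rotate freq_t 4 c) (phase3 ((i j)%:R / 160) (t' j) (s j)) ^+ 6 +
    5^-1 ^+ 6 * wave (rotate freq_s 1 c) (phase3 ((i j)%:R / 160) ((k j)%:R / 160) (s' j)) ^+ 6)].
    by move: (hp j); rewrite /i /k /x' /t' /s'; case: (p j) => -[[[? ?] ?] ?] ?.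
  have hx : \sum_j wave (rotate freq_x 1 c) (phase3 (x' j) (t j) (s j)) ^+ 6 <= sup S.
    apply: le_sup; exists (rotate freq_x 1 c), x', t, s; split => // [|j].
      by apply: le_trans cW; apply: mass_rotate => //; exact: freq_x_le.
    by have [] := hp j.
  have ht : \sum_j wave (rotate freq_t 4 c) (phase3 ((i j)%:R / 160) (t' j) (s j)) ^+ 6
      <= sup S.
    apply: le_sup; exists (rotate freq_t 4 c), (fun j => (i j)%:R / 160), t', s.
    split => // [|j].
      by apply: le_trans cW; apply: mass_rotate => //; exact: freq_t_le.
    by have [_ _ _ []] := hp j.
  have hs : \sum_j wave (rotate freq_s 1 c)
      (phase3 ((i j)%:R / 160) ((k j)%:R / 160) (s' j)) ^+ 6 <= sup S.
    apply: le_sup; exists (rotate freq_s 1 c), (fun j => (i j)%:R / 160),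
      (fun j => (k j)%:R / 160), s'; split => // [|j].
      by apply: le_trans cW; apply: mass_rotate => //; exact: freq_s_le.
    by have [_ _ _ []] := hp j.
  have hgr := hg c i k cW (fun j => let: And5 h _ _ _ _ := hp j in h)
    (fun j => let: And5 _ h _ _ _ := hp j in h).
  apply: (@le_trans _ _ (\sum_j 1024 *
    (wave c (phase3 ((i j)%:R / 160) ((k j)%:R / 160) 0) ^+ 6 +
    5^-1 ^+ 6 * wave (rotate freq_x 1 c) (phase3 (x' j) (t j) (s j)) ^+ 6 +
    5^-1 ^+ 6 * wave (rotate freq_t 4 c) (phase3 ((i j)%:R / 160) (t' j) (s j)) ^+ 6 +
    5^-1 ^+ 6 * wave (rotate freq_s 1 c) (phase3 ((i j)%:R / 160) ((k j)%:R / 160) (s' j)) ^+ 6))).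
    by apply: ler_sum => j _; have [_ _ _ _ h] := hp j; exact: h.
  rewrite -mulr_sumr !big_split /= -!mulr_sumr.
  have S1 : 0 <= sup S.
    rewrite (le_trans _ hx) //; apply: sumr_ge0 => j _; exact: exprn_even_ge0.
  exact: absorption_arith.
have : \sum_j wave c0 (phase3 (x0 j) (t0 j) (s0 j)) ^+ 6 <= sup S.
  by apply: le_sup; exists c0, x0, t0, s0; split.
by move=> h; apply: (le_trans h); apply: half_absorb.
Qed.

End GridMaximal.

(** * From sampled points to the sixth moment on the group *)

Section GridSixth.
Context {R : realType}.
Variables (N : nat) (phi : nat -> R) (psi : nat -> nat).
Hypothesis N0 : (0 < N)%N.
Local Notation P1 := (160 * N)%N.
Local Notation P2 := (25600 * N ^ 2)%N.
Local Notation X := [the finType of ('I_P1 * 'I_P2)%type].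
Implicit Types c : nat -> R[i].

Lemma sum_inj_le (I J : finType) (e : I -> J) (h : J -> R) :
  injective e -> (forall y, 0 <= h y) -> \sum_i h (e i) <= \sum_y h y.
Proof.
move=> ie h0; rewrite -(big_imset h (in2W ie)) /= big_mkcond.
by apply: ler_sum => y _; case: ifP.
Qed.

(** At a grid point the spacing 1/160 turns the two phases into multiples of 1/(160 N) and 1/(25600
    N^2), which explains [P1] and [P2]. *)
Lemma wave_sqr_le_sqsum c (x : X) :
  wave N c (phase3 N phi psi (x.1%:R / 160) (x.2%:R / 160) 0) ^+ 2 <=
  sqsum N X (grid_char P1 P2 psi) c x.
Proof.
have NR : N%:R != 0 :> R by rewrite pnatr_eq0 -lt0n.
rewrite /sqsum (_ : expsum _ _ _ c x = \sum_(n < N) c n *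
   cis (2 * pi * phase3 N phi psi (x.1%:R / 160) (x.2%:R / 160) 0 n)).
  by rewrite waveE /sqn lerDl sqr_ge0.
apply: eq_bigr => n _; rewrite /grid_char; congr (_ * cis (_ * _)).
rewrite /phase3 /freq_x /freq_t mul0r addr0.
rewrite (natrM _ 160 N) (natrM _ 25600 (N ^ 2)) (natrX _ N 2).
have e160 : 160%:R != 0 :> R by [].
have e25600 : 25600%:R = 160 * 160 :> R by rewrite -natrM.
by rewrite e25600; field.
Qed.

Lemma grid_bound_sixth (W D : R) : 0 <= D ->
  sixth_bound N X (grid_char P1 P2 psi) N D ->
  grid_bound N phi psi W (D * (#|X|%:R * W ^+ 3)).
Proof.
move=> D0 hD c0 i k cW hi hk.
(* [supp_in] restricts all indices while the sums see only [n < N], so the coefficients are cut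
   off. *)
pose c n := if (n < N)%N then c0 n else 0.
have mc : l2mass N c = l2mass N c0.
  by apply: eq_bigr => n _; rewrite /c ltn_ord.
have wc th : wave N c0 th = wave N c th.
  by apply: eq_bigr => n _; rewrite /c ltn_ord.
have cs : supp_in c 0 N by move=> n; rewrite /c; case: ifP => //; rewrite eqxx.
have i1 j : (i j < P1)%N.
  by have /andP[_ h] := hi j; rewrite (leq_trans h) // leq_mul2l ltn_ord.
have k1 j : (k j < P2)%N.
  rewrite (leq_ltn_trans (hk j)) // ltn_mul2r expn_gt0 N0 //.
pose e (j : 'I_N) : X := (Ordinal (i1 j), Ordinal (k1 j)).
have ie : injective e.
  move=> j j' [eij _]; apply/val_inj => /=.
  have /andP[h1 h2] := hi j; have /andP[h3 h4] := hi j'; rewrite eij in h1 h2.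
  by move: h1 h2 h3 h4; rewrite !mulnS; lia.
apply: (@le_trans _ _ (sixth_moment N X (grid_char P1 P2 psi) c)); last first.
  apply: (le_trans (hD c 0%N cs)); rewrite mc ler_wpM2l // ler_wpM2l //.
  by rewrite lerXn2r ?nnegrE ?mass_ge0 // (le_trans _ cW) ?mass_ge0.
have h0 (x : X) : 0 <= sqsum N X (grid_char P1 P2 psi) c x ^+ 3.
  by rewrite exprn_ge0 ?sqsum_ge0.
apply: le_trans (sum_inj_le _ _ _ _ ie h0).
apply: ler_sum => j _; rewrite wc.
have := wave_sqr_le_sqsum c (e j).
rewrite [e j in X in X -> _]/= => h.
rewrite [leLHS](_ : _ = (wave N c (phase3 N phi psi ((i j)%:R / 160)
   ((k j)%:R / 160) 0) ^+ 2) ^+ 3); last by rewrite -exprM.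
by rewrite lerXn2r ?nnegrE ?sqr_ge0 ?sqsum_ge0.
Qed.

End GridSixth.

(** * Sixth-power bound for a uniformly convex sequence *)

Section MaximalSixth.
Context {R : realType}.
Variables (N : nat) (a br bi : nat -> R).
Hypothesis N0 : (0 < N)%N.
Hypothesis aC : unif_convex N a.

(** Indices start at 0, and subtracting [a 1] only costs a unimodular factor. The scale [160 N^2]
    puts the second differences between 40 and 640. *)
Definition lift_freq (n : nat) : R := 160 * N%:R ^+ 2 * (a n.+1 - a 1).
Definition floor_freq (n : nat) : nat := Num.truncn (lift_freq n).
Definition coef (n : nat) : R[i] := (br n.+1 +i* bi n.+1)%C.

Lemma lift_freq_bounds n : (n < N)%N ->
  0 <= lift_freq n <= 640 * N%:R * n%:R.
Proof.
have NR : 0 < N%:R :> R by rewrite ltr0n.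
rewrite /lift_freq; elim: n => [|n IH] nN; first by rewrite subrr !mulr0 lexx.
have /andP[h1 h2] := IH (ltnW nN).
have /andP[h3 h4] : (4 * N%:R)^-1 <= a n.+2 - a n.+1 <= 4 / N%:R.
  by apply: aC.1 => //; rewrite addn1.
have e : 160 * N%:R ^+ 2 * (a n.+2 - a 1) =
  160 * N%:R ^+ 2 * (a n.+1 - a 1) + 160 * N%:R ^+ 2 * (a n.+2 - a n.+1) by ring.
have p : 0 <= 160 * N%:R ^+ 2 :> R by rewrite mulr_ge0 // exprn_ge0.
rewrite e; apply/andP; split.
  rewrite addr_ge0 // mulr_ge0 // (le_trans _ h3) // invr_ge0 mulr_ge0 //.
have : 160 * N%:R ^+ 2 * (a n.+2 - a n.+1) <= 160 * N%:R ^+ 2 * (4 / N%:R).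
  by rewrite ler_wpM2l.
have -> : 160 * N%:R ^+ 2 * (4 / N%:R) = 640 * N%:R :> R by field; rewrite gt_eqF.
by rewrite -natr1; lra.
Qed.

Lemma lift_freq_le n : (n < N)%N -> lift_freq n <= 640 * N%:R ^+ 2.
Proof.
move=> nN; have /andP[_ h] := lift_freq_bounds n nN; rewrite (le_trans h) //.
rewrite (_ : 640 * N%:R ^+ 2 = 640 * N%:R * N%:R); last by ring.
by apply: ler_wpM2l; [rewrite mulr_ge0 ?ler0n|rewrite ler_nat ltnW].
Qed.

Lemma floor_freqP n : (n < N)%N ->
  (floor_freq n)%:R <= lift_freq n < (floor_freq n)%:R + 1.
Proof.
by move=> nN; rewrite natr1; apply: truncn_itv; case/andP: (lift_freq_bounds n nN).
Qed.

Lemma lift_freq_convex n : (n.+2 < N)%N ->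
  40 <= (lift_freq n.+2 - lift_freq n.+1) - (lift_freq n.+1 - lift_freq n)
     <= 16 * 40.
Proof.
have NR : 0 < N%:R :> R by rewrite ltr0n.
move=> nN; have /andP[h1 h2] : (4 * N%:R ^+ 2)^-1 <=
    (a n.+3 - a n.+2) - (a n.+2 - a n.+1) <= 4 / N%:R ^+ 2.
  by apply: aC.2 => //; rewrite addn2.
have p : 0 < 160 * N%:R ^+ 2 :> R by rewrite mulr_gt0 // exprn_gt0.
have -> : (lift_freq n.+2 - lift_freq n.+1) - (lift_freq n.+1 - lift_freq n) =
  160 * N%:R ^+ 2 * ((a n.+3 - a n.+2) - (a n.+2 - a n.+1)).
  by rewrite /lift_freq; ring.
have -> : 40 = 160 * N%:R ^+ 2 * (4 * N%:R ^+ 2)^-1 :> R.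
  by field; rewrite gt_eqF.
have -> : 16 * (160 * N%:R ^+ 2 * (4 * N%:R ^+ 2)^-1) =
   160 * N%:R ^+ 2 * (4 / N%:R ^+ 2) :> R by field; rewrite gt_eqF.
by rewrite (ler_wpM2l (ltW p) h1) (ler_wpM2l (ltW p) h2).
Qed.

Lemma floor_freq_transversality :
  transversality (R := R) N [the finType of ('I_(160 * N) * 'I_(25600 * N ^ 2))%type]
    (grid_char (160 * N) (25600 * N ^ 2) floor_freq) 17.
Proof.
apply: (grid_transversality N _ _ lift_freq floor_freq 40).
- by rewrite ler_nat.
- by rewrite leq_mul2r orbT.
- move=> n nN; rewrite -(ltr_nat R) (natrM _ 3) (natrM _ 25600 (N ^ 2)) (natrX _ N 2).
  have /andP[h _] := floor_freqP n nN; have h2 := lift_freq_le n nN.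
  have : 0 < N%:R ^+ 2 :> R by rewrite exprn_gt0 ?ltr0n.
  by lra.
- exact: floor_freqP.
- exact: lift_freq_convex.
Qed.

Lemma mass_coef : l2mass N coef = l2norm N br bi ^+ 2.
Proof.
rewrite /l2norm sqr_sqrtr; last first.
  by apply: sumr_ge0 => n _; rewrite addr_ge0 ?sqr_ge0.
by rewrite big_add1 /= big_mkord.
Qed.

(** Multiplication by -i, which makes the imaginary part of a sum available as a [wave]. *)
Definition turn (c : nat -> R[i]) (n : nat) : R[i] := c n * (0 -i* 1)%C.

Lemma mass_turn c : l2mass N (turn c) = l2mass N c.
Proof.
apply: eq_bigr => n _; rewrite /turn sqnM [X in _ * X](_ : _ = 1) ?mulr1 //.
by rewrite /sqn /= expr0n add0r sqrrN expr1n.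
Qed.

Lemma esum_absE x t :
  let th := phase3 N lift_freq floor_freq x t (t / (160 * N%:R ^+ 2)) in
  esum_abs N a br bi x t ^+ 2 = wave N coef th ^+ 2 + wave N (turn coef) th ^+ 2.
Proof.
have NR : 0 < N%:R :> R by rewrite ltr0n.
move=> th.
pose z := \sum_(n < N) coef n * cis (2 * pi * th n).
pose u := cis (2 * pi * (x / N%:R + t * a 1)).
have e (n : nat) : phase N a x t n.+1 =
    2 * pi * (x / N%:R + t * a 1) + 2 * pi * th n.
  rewrite /phase /th /phase3 /freq_x /freq_t /freq_s /lift_freq -natr1.
  by field; rewrite gt_eqF.
have uz : u * z = \sum_(n < N) coef n * cis (phase N a x t n.+1).
  rewrite mulr_sumr; apply: eq_bigr => n _.
  by rewrite mulrCA -cisD e.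
rewrite /esum_abs sqr_sqrtr ?addr_ge0 ?sqr_ge0 //.
transitivity (sqn (u * z)).
  rewrite uz /sqn !raddf_sum /esum_re /esum_im !big_add1 /= !big_mkord.
  congr (_ ^+ 2 + _ ^+ 2); apply: eq_bigr => n _ //=.
rewrite sqnM sqn_cis mul1r /sqn !waveE -/z; congr (_ + _ ^+ 2).
have -> : \sum_(n < N) turn coef n * cis (2 * pi * th n) = z * (0 -i* 1)%C.
  by rewrite mulr_suml; apply: eq_bigr => n _; rewrite /turn mulrAC.
by move: (z) => [p q] /=; ring.
Qed.

Lemma maximal_sixth_aux (D : R) (x t : 'I_N -> R) : 0 <= D ->
  sixth_bound N [the finType of ('I_(160 * N) * 'I_(25600 * N ^ 2))%type]
    (grid_char (160 * N) (25600 * N ^ 2) floor_freq) N D ->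
  (forall j : 'I_N, j%:R <= x j <= j%:R + 1 /\ 0 <= t j <= N%:R ^+ 2) ->
  \sum_j esum_abs N a br bi (x j) (t j) ^+ 6 <=
  8 * (2048 * (D * ((160 * N * (25600 * N ^ 2))%:R * (l2norm N br bi ^+ 2) ^+ 3))).
Proof.
have NR : 0 < N%:R :> R by rewrite ltr0n.
move=> D0 hD hxt; rewrite -mass_coef; set W := l2mass N coef.
have hg := grid_bound_sixth N lift_freq floor_freq N0 W D D0 hD.
rewrite card_prod !card_ord in hg; move: hg; set g := D * _ => hg.
pose s j := t j / (160 * N%:R ^+ 2).
have N2 : 0 < N%:R ^+ 2 :> R by rewrite exprn_gt0.
have cl (j : 'I_N) : cell N j (x j) (t j) (s j).
  have [hx /andP[t0 t1]] := hxt j; split => //; first by rewrite t0.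
  rewrite /s divr_ge0 ?mulr_ge0 ?exprn_ge0 //= invfM mulrCA ler_piMr ?invr_ge0 //.
  by rewrite ler_pdivrMr // mul1r.
have absorb := grid_absorption N lift_freq floor_freq N0 floor_freqP lift_freq_le W g hg.
have h1 := absorb coef x t s (lexx _) cl.
have tW : l2mass N (turn coef) <= W by rewrite mass_turn.
have h2 := absorb (turn coef) x t s tW cl.
(* Uses (u^2 + v^2)^3 <= 4 (u^6 + v^6) for the real and imaginary parts. *)
apply: (@le_trans _ _ (\sum_j (4 * wave N coef (phase3 N lift_freq floor_freq (x j) (t j) (s j)) ^+ 6 +
  4 * wave N (turn coef) (phase3 N lift_freq floor_freq (x j) (t j) (s j)) ^+ 6))).
  apply: ler_sum => j _.
  rewrite [leLHS](_ : _ = (esum_abs N a br bi (x j) (t j) ^+ 2) ^+ 3); last by rewrite -exprM.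
  rewrite esum_absE /= -/(s j).
  set u := wave N coef _; set v := wave N (turn coef) _; rewrite -subr_ge0.
  rewrite (_ : _ - _ = 3 * ((u ^+ 2 + v ^+ 2) * (u ^+ 2 - v ^+ 2) ^+ 2)); last by ring.
  by rewrite mulr_ge0 // mulr_ge0 ?sqr_ge0 // addr_ge0 ?sqr_ge0.
rewrite big_split /= -!mulr_sumr.
by move: h1 h2; set u := \sum_j _; set v := \sum_j _; move: u v g {hg absorb} => u v g; lra.
Qed.

End MaximalSixth.

Lemma maximal_sixth (R : realType) (lam : R) : 0 < lam ->
  exists2 C : R, 0 < C & forall (N : nat) (a br bi : nat -> R), (0 < N)%N ->
  unif_convex N a -> forall x t : 'I_N -> R,
  (forall j : 'I_N, j%:R <= x j <= j%:R + 1 /\ 0 <= t j <= N%:R ^+ 2) ->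
  \sum_j esum_abs N a br bi (x j) (t j) ^+ 6 <=
  C * N%:R ^+ 3 * N%:R `^ lam * l2norm N br bi ^+ 6.
Proof.
move=> lam0; have [C C1 hC] := sixth_exponent_all R 17 lam lam0.
have C0 : 0 < C := lt_le_trans ltr01 C1.
exists (8 * (2048 * (C * (160 * 25600)%:R))).
  by rewrite !mulr_gt0 ?ltr0n.
move=> N a br bi N0 aC x t hxt.
have hD := hC N _ _ (sqn_grid_char _ _ _) (floor_freq_transversality N a N0 aC) N N0.
have D0 : 0 <= C * N%:R `^ lam by rewrite mulr_ge0 ?powR_ge0 // ltW.
apply: (le_trans (maximal_sixth_aux N a br bi N0 aC _ x t D0 hD hxt)).
rewrite le_eqVlt; apply/orP; left; apply/eqP.
rewrite (natrM _ (160 * N) (25600 * N ^ 2)) (natrM _ 160 25600).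
rewrite (natrM _ 160 N) (natrM _ 25600 (N ^ 2)) (natrX _ N 2).
move: (N%:R `^ lam) (l2norm _ _ _) (160%:R : R) (25600%:R : R) => u v p q; ring.
Qed.

(** * The upper bound *)

Section MeasureTheory.
Local Open Scope classical_set_scope.
Local Open Scope ring_scope.
Context {R : realType}.

(** The integral of a nonnegative function is a supremum over simple functions below it, hence
    monotone for arbitrary functions. It is applied to the maximal function. *)
Lemma ge0_integral_mono d (T : measurableType d) (mu : {measure set T -> \bar R})
    (D : set T) (f g : T -> \bar R) :
  (forall x, D x -> 0 <= f x)%E -> (forall x, D x -> f x <= g x)%E ->
  (\int[mu]_(x in D) f x <= \int[mu]_(x in D) g x)%E.
Proof.
move=> f0 fg; have g0 x : D x -> (0 <= g x)%E.
  by move=> Dx; exact: le_trans (f0 x Dx) (fg x Dx).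
rewrite (ge0_integralE mu f0) (ge0_integralE mu g0).
apply: ereal_sup_le => _ [h hf <-].
exists h => // x; apply: (le_trans (hf x)); rewrite /patch.
by case: ifPn => // /set_mem /fg.
Qed.

(** Freezing the other summands bounds each [A j]; then every supremum is approximated within
    [e / n.+1]. *)
Lemma sum_sup_le (n : nat) (A : 'I_n -> set R) (S : R) :
  (forall j, A j !=set0) ->
  (forall v : 'I_n -> R, (forall j, A j (v j)) -> \sum_j v j <= S) ->
  (forall j, has_ubound (A j)) /\ \sum_j sup (A j) <= S.
Proof.
move=> A0 hS; have ub j : has_ubound (A j).
  have /choice[v0 hv0] : forall i, exists v, A i v by move=> i; exact: A0.
  exists (S - \sum_(i | i != j) v0 i) => w Aw.
  have := hS (fun i => if i == j then w else v0 i) _.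
  rewrite (bigD1 j) //= eqxx lerBrDr (eq_bigr v0); last by move=> i /negbTE ->.
  by apply => i; case: eqP => [->|].
split=> //; apply/ler_addgt0Pr => e e0.
pose dl := e / n.+1%:R; have dl0 : 0 < dl by rewrite divr_gt0.
have /choice[v hv] : forall j, exists w, A j w /\ sup (A j) - dl < w.
  move=> j; have hs : has_sup (A j) by split.
  by have [w Aw lt] := sup_adherent dl0 hs; exists w.
apply: (@le_trans _ _ (\sum_(j < n) (v j + dl))).
  by apply: ler_sum => j _; have [_ h] := hv j; rewrite -lerBlDr ltW.
rewrite big_split /= lerD // ?hS // => [j|]; first by have [] := hv j.
rewrite sumr_const card_ord -mulr_natr /dl -mulrA ler_piMr ?(ltW e0) //.
by rewrite mulrC ler_pdivrMr // mul1r ler_nat.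
Qed.

Lemma integral_cells_le (N : nat) (f : R -> R) (K : 'I_N -> R) : (0 < N)%N ->
  (forall j, 0 <= K j) -> (forall x, 0 <= f x) ->
  (forall (j : 'I_N) x, j%:R <= x <= j%:R + 1 -> f x <= K j) ->
  (\int[lebesgue_measure]_(x in `[0%R, N%:R]%classic) (f x)%:E <=
    (\sum_j K j)%:E)%E.
Proof.
move=> N0 K0 f0 fK; set D := `[0%R, N%:R]%classic.
pose I (j : 'I_N) : set R := `[j%:R, j%:R + 1]%classic.
pose g (j : 'I_N) (x : R) : \bar R := (K j * \1_(I j) x)%:E.
have mI j : measurable (I j) by exact: measurable_itv.
have mD : measurable D by exact: measurable_itv.
apply: (@le_trans _ _ (\int[lebesgue_measure]_(x in D) (\sum_(j < N) g j x))%E).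
  apply: ge0_integral_mono => x; rewrite /D /= in_itv /= => /andP[x0 xN].
    by rewrite lee_fin.
  have [j hj] : exists j : 'I_N, j%:R <= x <= j%:R + 1.
    have /andP[t1 t2] := truncn_itv x0.
    have [h|h] := ltnP (Num.truncn x) N.
      by exists (Ordinal h); rewrite /= t1 natr1 ltW.
    (* The endpoint x = N is assigned to the last cell. *)
    have h2 : (N.-1 < N)%N by rewrite prednK.
    exists (Ordinal h2); rewrite /= natr1 prednK // xN andbT.
    by rewrite (le_trans _ t1) // ler_nat (leq_trans (leq_pred _) h).
  rewrite /g sumEFin lee_fin (bigD1 j) //= (le_trans (fK j x hj)) //.
  rewrite indicE mem_set ?mulr1 ?lerDl; last by rewrite /I /= in_itv.
  by apply: sumr_ge0 => i _; rewrite mulr_ge0.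
rewrite (@ge0_integral_sum _ _ R lebesgue_measure D mD 'I_N g); last 2 first.
- move=> j; apply/measurable_EFinP; apply: measurable_funM => //.
  by apply: measurable_indic; exact: mI.
- by move=> j x _; rewrite lee_fin mulr_ge0.
rewrite -sumEFin; apply: lee_sum => j _.
have Kneg : (K j < 0)%R -> I j = set0 by rewrite ltNge K0.
rewrite [leLHS](@integralZl_indic _ _ R lebesgue_measure D mD (fun=> I j) (K j) Kneg (mI j)).
rewrite integral_indic; [|exact: mD|exact: mI].
rewrite -[leRHS]mule1; apply: lee_wpmul2l; first by rewrite lee_fin.
apply: (@le_trans _ _ (lebesgue_measure (I j))).
  apply: le_measure; rewrite ?inE; last by move=> x [].
    by apply: measurableI; [exact: mI|exact: mD].
  exact: mI.
rewrite lebesgue_measure_itv /= lte_fin ltrDl ltr01 -EFinB lee_fin.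
by rewrite addrAC subrr add0r.
Qed.

End MeasureTheory.

Section UpperBound.
Local Open Scope classical_set_scope.
Local Open Scope ring_scope.
Context {R : realType}.
Variables (N : nat) (a br bi : nat -> R) (S : R).
Hypothesis N0 : (0 < N)%N.
Local Notation E := (esum_abs N a br bi).
Hypothesis sixthS : forall x t : 'I_N -> R,
  (forall j : 'I_N, j%:R <= x j <= j%:R + 1 /\ 0 <= t j <= N%:R ^+ 2) ->
  \sum_j E (x j) (t j) ^+ 6 <= S.

Lemma esum_abs_ge0 x t : 0 <= E x t.
Proof. exact: sqrtr_ge0. Qed.

Lemma time_range_neq0 (x : R) :
  [set E x t | t in `[0, N%:R ^+ 2]%classic] !=set0.
Proof. by exists (E x 0), 0 => //; rewrite /= in_itv /= lexx exprn_ge0. Qed.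

Lemma maxfun_ge0 x : 0 <= maxfun N a br bi x.
Proof.
rewrite /maxfun; have [hs|hs] := pselect (has_ubound
    [set E x t | t in `[0, N%:R ^+ 2]%classic]); last first.
  (* The supremum of an unbounded set is 0 by convention. *)
  by rewrite sup_out // => -[].
apply: le_trans (ub_le_sup hs _); last first.
  by exists 0 => //; rewrite /= in_itv /= lexx exprn_ge0.
exact: esum_abs_ge0.
Qed.

(* [u^4 <= rho u^6 + rho^-2], optimized in [rho], replaces Hölder's inequality. *)
Lemma integral_maxfun_le (rho : R) : 0 < rho ->
  (\int[lebesgue_measure]_(x in `[0%R, N%:R]%classic)
     (maxfun N a br bi x ^+ 4)%:E <= (rho * S + N%:R * rho ^- 2)%:E)%E.
Proof.
move=> rho0.
pose A (j : 'I_N) : set R := [set v | exists x t : R,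
  [/\ j%:R <= x <= j%:R + 1, 0 <= t <= N%:R ^+ 2 & v = E x t ^+ 6]].
have A0 j : A j !=set0.
  by exists (E j%:R 0 ^+ 6), j%:R, 0; split; rewrite // lexx /= ?lerDl ?exprn_ge0.
have hA v : (forall j, A j (v j)) -> \sum_j v j <= S.
  move=> /choice[x /choice[t h]].
  have -> : \sum_j v j = \sum_j E (x j) (t j) ^+ 6.
    by apply: eq_bigr => i _; have [] := h i.
  by apply: sixthS => i; have [] := h i.
have [ub le] := sum_sup_le N A S A0 hA.
have sup0 j : 0 <= sup (A j).
  have [v Av] := A0 j; apply: le_trans (ub_le_sup (ub j) Av).
  by case: Av => x [t [_ _ ->]]; rewrite exprn_ge0 ?esum_abs_ge0.
have rho20 : 0 <= rho ^- 2 by rewrite invr_ge0 exprn_ge0 // ltW.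
have K0 j : 0 <= rho * sup (A j) + rho ^- 2.
  by rewrite addr_ge0 // mulr_ge0 // ltW.
apply: le_trans (integral_cells_le N (fun x => maxfun N a br bi x ^+ 4)
  (fun j => rho * sup (A j) + rho ^- 2) N0 K0 _ _) _.
- by move=> x; rewrite exprn_ge0 ?maxfun_ge0.
- move=> j x hx.
  (* A fourth root, so that a bound on fourth powers for each [t] passes to the supremum. *)
  pose r := Num.sqrt (Num.sqrt (rho * sup (A j) + rho ^- 2)).
  have r0 : 0 <= r by exact: sqrtr_ge0.
  have r4 : r ^+ 4 = rho * sup (A j) + rho ^- 2.
    by rewrite (exprM r 2 2) !sqr_sqrtr ?sqrtr_ge0.
  rewrite -r4 lerXn2r ?nnegrE ?maxfun_ge0 //.
  apply: ge_sup; first exact: time_range_neq0.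
  move=> _ [t ht <-]; rewrite /= in_itv /= in ht.
  rewrite -(ler_pXn2r (_ : 0 < 4)%N) ?nnegrE ?esum_abs_ge0 // r4.
  have h6 : E x t ^+ 6 <= sup (A j) by apply: ub_le_sup => //; exists x, t.
  apply: (@le_trans _ _ (rho * E x t ^+ 6 + rho ^- 2)); last first.
    by rewrite lerD2r ler_wpM2l // ltW.
  move: (esum_abs_ge0 x t); move: (E x t) => u u0.
  have [big|small] := leP 1 (rho * u ^+ 2).
    rewrite -[leLHS]addr0 lerD //.
    rewrite (_ : rho * u ^+ 6 = rho * u ^+ 2 * u ^+ 4); last by ring.
    by rewrite ler_peMl // exprn_ge0.
  have s1 : 0 <= rho * u ^+ 6 by rewrite mulr_ge0 ?exprn_ge0 // ltW.
  have s2 : u ^+ 2 <= rho^-1 by rewrite -[leRHS]mul1r ler_pdivlMr // mulrC ltW.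
  have s3 : u ^+ 4 <= rho ^- 2.
    rewrite (_ : u ^+ 4 = (u ^+ 2) ^+ 2); last by rewrite -exprM.
    by rewrite -exprVn lerXn2r ?nnegrE ?sqr_ge0 // invr_ge0 ltW.
  by rewrite -[leLHS]add0r lerD.
rewrite lee_fin big_split /= -mulr_sumr sumr_const card_ord mulr_natl lerD2r.
by rewrite ler_wpM2l // ltW.
Qed.

Lemma L4norm_le (Y : R) : 0 <= Y ->
  (\int[lebesgue_measure]_(x in `[0%R, N%:R]%classic)
     (maxfun N a br bi x ^+ 4)%:E <= (Y ^+ 4)%:E)%E ->
  (L4norm N (maxfun N a br bi) <= Y%:E)%E.
Proof.
move=> Y0 h; have -> : Y%:E = poweR (Y ^+ 4)%:E (4^-1).
  rewrite poweR_EFin -powR_mulrn // -powRrM mulfV // powRr1 //.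
apply: gt0_ler_poweR => //.
- rewrite in_itv /= leey andbT; apply: integral_ge0 => x _.
  by rewrite lee_fin exprn_ge0 ?maxfun_ge0.
- by rewrite in_itv /= leey andbT lee_fin exprn_ge0.
Qed.

End UpperBound.

Lemma maximal_estimate (R : realType) (eps : R) : 0 < eps ->
  exists Ceps : R, 0 < Ceps /\
  forall N : nat, (1 <= N)%N -> forall a br bi : nat -> R, unif_convex N a ->
  (L4norm N (maxfun N a br bi) <=
     (Ceps * N%:R `^ eps * N%:R `^ (7 / 12) * l2norm N br bi)%:E)%E.
Proof.
move=> eps0; have eps4 : 0 < 4 * eps by rewrite mulr_gt0.
have [C C0 hC] := maximal_sixth R (4 * eps) eps4.
have C10 : 0 < C + 1 by rewrite addr_gt0.
(* The sixth-moment loss [4 * eps] becomes [eps] after the fourth root, and [C + 1] collects both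
   terms of [integral_maxfun_le]. *)
exists ((C + 1) `^ (4^-1)); split; first exact: powR_gt0.
move=> N N0 a br bi aC; have NR : 0 < N%:R :> R by rewrite ltr0n.
set W := l2norm N br bi; have W0 : 0 <= W by exact: sqrtr_ge0.
set Y := (C + 1) `^ (4^-1) * _ * _ * W.
have Y0 : 0 <= Y by rewrite !mulr_ge0 ?powR_ge0.
have pow4 (u v : R) : 0 <= u -> (u `^ v) ^+ 4 = u `^ (v * 4).
  by move=> u0; rewrite -powR_mulrn ?powR_ge0 // -powRrM.
have Y4 : Y ^+ 4 = (C + 1) * N%:R `^ (4 * eps) * N%:R `^ (7 / 3) * W ^+ 4.
  rewrite /Y !exprMn !pow4 ?(ltW C10) // mulVf // powRr1 ?(ltW C10) //.
  by rewrite [eps * 4]mulrC (_ : 7 / 12 * 4 = 7 / 3) //; field.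
have bound := integral_maxfun_le N a br bi _ N0 (hC N a br bi N0 aC).
apply: L4norm_le => //.
have [W1|W1] := eqVneq W 0.
  rewrite Y4 W1 expr0n mulr0; apply/lee_addgt0Pr => e e0.
  (* For zero coefficients only [N / rho^2] remains; this choice makes it equal to [e]. *)
  pose rho := Num.sqrt (N%:R / e).
  have rho0 : 0 < rho by rewrite sqrtr_gt0 divr_gt0.
  apply: (le_trans (bound rho rho0)); rewrite -EFinD lee_fin.
  have r2 : rho ^+ 2 = N%:R / e by rewrite sqr_sqrtr // divr_ge0 // ltW.
  rewrite -/W W1 expr0n /= !mulr0 !add0r r2.
  by rewrite (_ : N%:R * (N%:R / e)^-1 = e) //; field; rewrite !gt_eqF //.
have Wp : 0 < W by rewrite lt_def W1.
(* Balances [rho N^3 W^6] against [N / rho^2]: both equal N^(7/3) W^4, whose fourth root carries the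
   exponent 7/12. *)
pose rho := N%:R `^ (- (2 / 3)) / W ^+ 2.
have rho0 : 0 < rho by rewrite divr_gt0 ?exprn_gt0 ?powR_gt0.
apply: (le_trans (bound rho rho0)); rewrite lee_fin Y4 -/W.
have NE : N%:R != 0 :> R by rewrite gt_eqF.
have e1 : N%:R `^ (- (2 / 3)) * N%:R ^+ 3 = N%:R `^ (7 / 3) :> R.
  by rewrite -powR_mulrn // -powRD ?NE ?implybT //; congr (_ `^ _); field.
have e2 : N%:R * (N%:R `^ (- (2 / 3)) ^- 2) = N%:R `^ (7 / 3) :> R.
  rewrite -[X in X * _ = _]powRr1 // -(powR_mulrn 2) ?powR_ge0 // -powRrM -powRN.
  by rewrite -powRD ?NE ?implybT //; congr (_ `^ _); field.
have p1 : 1 <= N%:R `^ (4 * eps) :> R.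
  by rewrite -[leLHS](powRr0 N%:R) ler_powR ?ler1n // ltW.
have -> : rho * (C * N%:R ^+ 3 * N%:R `^ (4 * eps) * W ^+ 6) =
   C * N%:R `^ (4 * eps) * N%:R `^ (7 / 3) * W ^+ 4.
  by rewrite -e1 /rho; move: (_ `^ _) (_ `^ _) => u v; field.
have -> : N%:R * rho ^- 2 = N%:R `^ (7 / 3) * W ^+ 4.
  rewrite -e2 /rho; have := powR_gt0 (- (2 / 3)) NR; move: (_ `^ _) => u u0.
  by field; rewrite W1 gt_eqF.
rewrite -subr_ge0 (_ : _ - _ = (N%:R `^ (4 * eps) - 1) * (N%:R `^ (7 / 3) * W ^+ 4));
  last by ring.
by rewrite mulr_ge0 ?subr_ge0 // mulr_ge0 ?powR_ge0 // exprn_ge0.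
Qed.

(** * The lower bound *)

Section LowerBound.
Local Open Scope classical_set_scope.
Local Open Scope ring_scope.
Context {R : realType}.

Lemma L4norm_ge (N : nat) (f : R -> R) (v Y : R) : (0 < N)%N -> 0 <= v -> 0 <= Y ->
  (forall x, 0 <= x <= N%:R -> v <= f x) -> Y ^+ 4 <= N%:R * v ^+ 4 ->
  (Y%:E <= L4norm N f)%E.
Proof.
move=> N0 v0 Y0 hf hY; have -> : Y%:E = poweR (Y ^+ 4)%:E (4^-1).
  by rewrite poweR_EFin -powR_mulrn // -powRrM mulfV // powRr1.
have h : ((Y ^+ 4)%:E <= \int[lebesgue_measure]_(x in `[0%R, N%:R]%classic) (f x ^+ 4)%:E)%E.
  apply: (@le_trans _ _ (\int[lebesgue_measure]_(x in `[0%R, N%:R]%classic) (v ^+ 4)%:E)%E).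
    have mu : lebesgue_measure (`[0%R, N%:R]%classic : set R) = N%:R%:E.
      by rewrite lebesgue_measure_itv /= lte_fin ltr0n N0 -EFinB subr0.
    rewrite integral_cst; last exact: measurable_itv.
    by rewrite [X in (_ * X)%E]mu -EFinM lee_fin mulrC.
  apply: ge0_integral_mono => x; rewrite /= in_itv /= => hx.
    by rewrite lee_fin exprn_ge0.
  by rewrite lee_fin lerXn2r ?nnegrE ?(le_trans v0) // hf.
apply: gt0_ler_poweR => //; rewrite in_itv /= leey andbT.
  by rewrite lee_fin exprn_ge0.
by apply: le_trans h; rewrite lee_fin exprn_ge0.
Qed.

Lemma maxfun_ge N (a br bi : nat -> R) x t : (0 < N)%N ->
  0 <= t <= N%:R ^+ 2 -> esum_abs N a br bi x t <= maxfun N a br bi x.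
Proof.
move=> N0 ht; apply: ub_le_sup; last by exists t.
(* Boundedness excludes the default value of [sup]; the extra 1 allows passing from y^2 to y. *)
exists (1 + (N%:R * l2mass N (coef br bi) + N%:R * l2mass N (coef br bi))).
move=> _ [s _ <-]; have := esum_absE N a br bi N0 x s; rewrite /=.
set th := phase3 _ _ _ _ _ _ => e.
have h1 := wave_sqr_le N (coef br bi) th.
have h2 := wave_sqr_le N (turn (coef br bi)) th; rewrite mass_turn in h2.
have h : esum_abs N a br bi x s ^+ 2 <=
    N%:R * l2mass N (coef br bi) + N%:R * l2mass N (coef br bi) by rewrite e lerD.
have [le1|/ltW gt1] := leP (esum_abs N a br bi x s) 1.
  by rewrite (le_trans le1) // lerDl (le_trans _ h) // sqr_ge0.
have h3 : esum_abs N a br bi x s <= esum_abs N a br bi x s ^+ 2.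
  by rewrite expr2 ler_peMr // (le_trans ler01).
by apply: (le_trans h3); apply: (le_trans h); rewrite lerDr.
Qed.

Lemma cos_ge_half (y : R) : 0 <= y <= 8^-1 -> 2^-1 <= cos (2 * pi * y).
Proof.
move=> /andP[y0 y1]; have p0 := pi_gt0 R.
have t0 : 0 <= 2 * pi * y by rewrite mulr_ge0 // mulr_ge0 // ltW.
have t1 : 2 * pi * y <= pi / 4.
  rewrite (_ : pi / 4 = 2 * pi * 8^-1); last by field.
  by rewrite ler_wpM2l // mulr_ge0 // ltW.
move: (2 * pi * y) t0 t1 => th t0 t1.
have c0 : 0 <= cos th by apply: cos_ge0_pihalf; apply/andP; split; lra.
have : 0 <= cos (th *+ 2).
  by apply: cos_ge0_pihalf; rewrite [th *+ 2]mulr2n; apply/andP; split; lra.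
by rewrite cos_mulr2n; nra.
Qed.

Lemma cosDnat (th : R) (n : nat) : cos (th + 2 * pi * n%:R) = cos th.
Proof.
elim: n => [|n IH]; first by rewrite mulr0 addr0.
rewrite (_ : th + _ = th + 2 * pi * n%:R + pi *+ 2) ?cosD2pi //.
by rewrite -[pi *+ 2]mulr_natl -[n.+1%:R]natr1; ring.
Qed.

Lemma sum_dvdn (N q : nat) : (0 < q)%N ->
  (\sum_(1 <= n < N.+1) (q %| n : nat))%N = (N %/ q)%N.
Proof.
move=> q0; elim: N => [|N IH]; first by rewrite big_nil div0n.
by rewrite big_nat_recr //= IH divnS // addnC.
Qed.

(** The least [q] with q^3 >= 8 N. If 2 q > N, then p = q - 1 is at least 5 and 25 p <= p^3 < 8 N <
    16 (p + 1), which is impossible. *)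
Lemma cube_scale (N : nat) : (10 <= N)%N -> exists q : nat,
  [/\ (0 < q)%N, (8 * N <= q ^ 3)%N, (q.-1 ^ 3 < 8 * N)%N & (2 * q <= N)%N].
Proof.
move=> N10; have ex : exists q, (8 * N <= q ^ 3)%N.
  exists (8 * N)%N; rewrite -{1}[(8 * N)%N]expn1 leq_pexp2l // muln_gt0.
  exact: leq_trans N10.
case: (ex_minnP ex) => q hq qmin; exists q.
have q0 : (0 < q)%N.
  rewrite lt0n; apply: contraTneq hq => ->.
  by rewrite exp0n // -ltnNge muln_gt0 (leq_trans _ N10).
have q1 : (q.-1 ^ 3 < 8 * N)%N.
  by rewrite ltnNge; apply/negP => /qmin; case: q q0 {hq qmin} => //= q _; rewrite ltnn.
split=> //; rewrite leqNgt; apply/negP => Nq.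
case: q q0 q1 Nq {hq qmin ex} => //= p _ q1 Nq.
have p5 : (5 <= p)%N by lia.
have : (25 * p <= p ^ 3)%N.
  rewrite expnS mulnC leq_mul2l; apply/orP; right.
  by rewrite (leq_trans _ (_ : 5 ^ 2 <= _)%N) // leq_sqr.
lia.
Qed.

Section Example.
Variables N q : nat.
Hypothesis N10 : (10 <= N)%N.
Hypothesis q0 : (0 < q)%N.
Hypothesis q3 : (8 * N <= q ^ 3)%N.
Hypothesis qN : (2 * q <= N)%N.
Local Notation S := (N %/ q)%N.

(** The quadratic term supplies the curvature. The linear term has slope between 1/(2N) and 1/N and
    contributes an integer phase at the times used. The last term makes each time step act as a
    translation of [x] by 1/8. *)
Definition example_freq (n : nat) : R :=
  n%:R ^+ 2 / N%:R ^+ 2 + n%:R * (S%:R * q%:R / N%:R ^+ 2)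
  - n%:R * q%:R ^+ 2 / (8 * N%:R ^+ 3).
Definition example_coef (n : nat) : R := (q %| n)%:R.

Lemma example_step : N%:R / 2 <= (S * q)%:R :> R /\ (S * q)%:R <= N%:R :> R.
Proof.
have h := divn_eq N q; have h2 := ltn_pmod N q0.
rewrite ler_nat; split; last by rewrite leq_trunc_div.
by rewrite ler_pdivrMr // -natrM ler_nat; lia.
Qed.

Lemma example_convex : unif_convex N example_freq.
Proof.
have NR : 0 < N%:R :> R by rewrite ltr0n (leq_trans _ N10).
have [s1 s2] := example_step; rewrite natrM in s1 s2.
have q2 : 2 * q%:R <= N%:R :> R by rewrite -natrM ler_nat.
split=> n n1 nN.
  have e : example_freq n.+1 - example_freq n =
      ((2 * n%:R + 1) + S%:R * q%:R - q%:R ^+ 2 / (8 * N%:R)) / N%:R ^+ 2.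
    by rewrite /example_freq -[n.+1%:R]natr1; field; rewrite gt_eqF.
  have n1R : 1 <= n%:R :> R by rewrite ler1n.
  have nNR : n%:R + 1 <= N%:R :> R by rewrite natr1 ler_nat -addn1.
  have t0 : 0 <= q%:R ^+ 2 / (8 * N%:R) :> R by rewrite divr_ge0 ?sqr_ge0 ?mulr_ge0.
  have t1 : q%:R ^+ 2 / (8 * N%:R) <= N%:R / 32 :> R.
    rewrite ler_pdivrMr ?mulr_gt0 //.
    rewrite (_ : N%:R / 32 * (8 * N%:R) = (N%:R / 2) ^+ 2); last by field.
    by rewrite lerXn2r ?nnegrE ?divr_ge0 // ler_pdivlMr // mulrC.
  rewrite e; move: (_ / (8 * _)) t0 t1 => w t0 t1; apply/andP; split.
    have h4 : (4 * N%:R)^-1 * N%:R ^+ 2 = N%:R / 4 :> R by field; rewrite gt_eqF.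
    by rewrite ler_pdivlMr ?exprn_gt0 // h4; lra.
  have h4 : 4 / N%:R * N%:R ^+ 2 = 4 * N%:R :> R by field; rewrite gt_eqF.
  by rewrite ler_pdivrMr ?exprn_gt0 // h4; lra.
have e : example_freq n.+2 - example_freq n.+1 - (example_freq n.+1 - example_freq n) =
    2 / N%:R ^+ 2.
  by rewrite /example_freq -[n.+2%:R]natr1 -[n.+1%:R]natr1; field; rewrite gt_eqF.
have i0 : 0 <= N%:R ^- 2 :> R by rewrite invr_ge0 exprn_ge0.
by rewrite e invfM; apply/andP; split; lra.
Qed.

(* At time t = (N/q)^2 k the phase of the frequency n = q m is congruent to
   m (q/N) (x - k/8) modulo 1; the choice of l, k with 0 <= x - l N/q - k/8 < 1/8
   brings it to [0, 1/8]. *)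
Lemma example_alignment (x : R) : 0 <= x <= N%:R -> exists2 t : R,
  0 <= t <= N%:R ^+ 2 & forall n, (1 <= n <= N)%N -> (q %| n)%N ->
    2^-1 <= cos (phase N example_freq x t n).
Proof.
move=> /andP[x0 xN].
have NR : 0 < N%:R :> R by rewrite ltr0n (leq_trans _ N10).
have qR : 0 < q%:R :> R by rewrite ltr0n.
have u0 : 0 <= x * q%:R / N%:R by rewrite divr_ge0 // mulr_ge0.
have /andP[l1 l2] := truncn_itv u0; set l := Num.truncn _ in l1 l2.
pose y := x - l%:R * (N%:R / q%:R).
have y0 : 0 <= y.
  by rewrite subr_ge0 mulrA ler_pdivrMr // -ler_pdivlMr.
have y1 : y <= N%:R / q%:R.
  rewrite lerBlDl -[X in _ + X]mul1r -mulrDl natr1 mulrA ler_pdivlMr //.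
  by rewrite -ler_pdivrMr // ltW.
have y80 : 0 <= 8 * y by rewrite mulr_ge0.
have /andP[k1 k2] := truncn_itv y80; set k := Num.truncn _ in k1 k2.
(* This keeps [t] at most N^2, and it is where q^3 >= 8 N enters: 8 y <= 8 N / q <= q^2. *)
have kq : k%:R <= q%:R ^+ 2 :> R.
  rewrite (le_trans k1) // (@le_trans _ _ (8 * (N%:R / q%:R))) ?ler_wpM2l //.
  by rewrite mulrA ler_pdivrMr // -exprSr -natrX -natrM ler_nat.
exists (N%:R ^+ 2 / q%:R ^+ 2 * k%:R).
  apply/andP; split; first by rewrite !mulr_ge0 ?invr_ge0 ?exprn_ge0.
  by rewrite mulrAC ler_pdivrMr ?exprn_gt0 // ler_wpM2l ?exprn_ge0.
move=> n /andP[n1 nN] /dvdnP[m nE].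
pose w := m%:R * (q%:R / N%:R) * (y - k%:R / 8).
have mq : m%:R * q%:R <= N%:R :> R by rewrite -natrM ler_nat -nE.
have yk0 : 0 <= y - k%:R / 8 by rewrite subr_ge0 ler_pdivrMr // mulrC.
have yk1 : y - k%:R / 8 <= 8^-1.
  by move: k2; rewrite -[k.+1%:R]natr1 => k2; lra.
have c0 : 0 <= m%:R * (q%:R / N%:R) :> R by rewrite mulr_ge0 // divr_ge0.
have c1 : m%:R * (q%:R / N%:R) <= 1 :> R.
  by rewrite mulrA ler_pdivrMr // mul1r.
have w0 : 0 <= w by rewrite mulr_ge0.
have w1 : w <= 8^-1.
  by rewrite (le_trans _ yk1) // ler_piMl.
(* The integer collects the translation of [x] by l N / q, the quadratic term and the linear
   term. *)
have -> : phase N example_freq x (N%:R ^+ 2 / q%:R ^+ 2 * k%:R) n =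
    2 * pi * w + 2 * pi * (m * l + k * m ^ 2 + k * S * m)%:R.
  rewrite !natrD (natrM _ m l) (natrM _ k (m ^ 2)) (natrM _ (k * S) m).
  rewrite (natrM _ k S) (natrX _ m 2) /phase /example_freq /w /y nE (natrM _ m q).
  by field; rewrite !gt_eqF.
by rewrite cosDnat cos_ge_half // w0.
Qed.

Lemma example_mass : \sum_(1 <= n < N.+1) example_coef n = S%:R.
Proof. by rewrite -(sum_dvdn N q q0) natr_sum. Qed.

Lemma example_l2norm : l2norm N example_coef (fun=> 0) = Num.sqrt S%:R.
Proof.
rewrite /l2norm -example_mass; congr Num.sqrt; apply: eq_bigr => n _.
by rewrite expr0n addr0 /example_coef; case: (q %| n)%N; rewrite ?expr1n ?expr0n.
Qed.

Lemma example_maxfun (x : R) : 0 <= x <= N%:R ->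
  S%:R / 2 <= maxfun N example_freq example_coef (fun=> 0) x.
Proof.
move=> hx; have [t ht hc] := example_alignment x hx.
have N0 : (0 < N)%N by exact: leq_trans N10.
apply: le_trans (maxfun_ge N example_freq example_coef (fun=> 0) x t N0 ht).
have re : S%:R / 2 <= esum_re N example_freq example_coef (fun=> 0) x t.
  rewrite -example_mass mulr_suml /esum_re !big_nat; apply: ler_sum => n hn.
  rewrite mul0r subr0 /example_coef; case: (boolP (q %| n)%N) => qn; last by rewrite !mul0r.
  by rewrite !mul1r hc.
rewrite /esum_abs (le_trans re) // (le_trans (ler_norm _)) // -sqrtr_sqr.
by rewrite ler_wsqrtr // lerDl sqr_ge0.
Qed.

End Example.

(** The maximal function is at least S / 2 on all of [0, N], so its norm is at least N^(1/4) S / 2,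
    against an l^2 norm of S^(1/2) with S of order N^(2/3). *)
Lemma maximal_sharp (N : nat) : (10 <= N)%N ->
  exists a br bi : nat -> R, unif_convex N a /\ 0 < l2norm N br bi /\
   ((5^-1 * N%:R `^ (7 / 12) * l2norm N br bi)%:E <= L4norm N (maxfun N a br bi))%E.
Proof.
move=> N10; have [q [q0 q3 q1 qN]] := cube_scale N N10.
have N0 : (0 < N)%N by exact: leq_trans N10.
have NR : 0 < N%:R :> R by rewrite ltr0n.
exists (example_freq N q), (example_coef q), (fun=> 0).
split; first exact: example_convex.
have S0 : (0 < N %/ q)%N by rewrite divn_gt0 //; lia.
set S : R := (N %/ q)%:R; have SR : 0 < S by rewrite ltr0n.
rewrite example_l2norm // -/S; split; first by rewrite sqrtr_gt0.
apply: (L4norm_ge N _ (S / 2)) => //; rewrite ?divr_ge0 ?mulr_ge0 ?powR_ge0 ?sqrtr_ge0 ?(ltW SR) //.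
  by move=> x hx; exact: example_maxfun.
pose u : R := N%:R `^ (3^-1).
have u0 : 0 < u by exact: powR_gt0.
have u3 : u ^+ 3 = N%:R by rewrite /u -powR_mulrn ?powR_ge0 // -powRrM mulVf // powRr1 // ltW.
have u1 : 1 <= u by rewrite -[leLHS](powRr0 N%:R) ler_powR ?ler1n // invr_ge0.
have qu : q%:R <= 3 * u.
  have : q.-1%:R < 2 * u.
    rewrite -(ltr_pXn2r (_ : 0 < 3)%N) ?nnegrE ?mulr_ge0 ?(ltW u0) //.
    by rewrite exprMn u3 -natrX -[2 ^+ 3]natrX -natrM ltr_nat.
  by rewrite -{2}(prednK q0) -natr1; lra.
have Sq : u ^+ 3 <= 2 * S * q%:R.
  rewrite u3 /S -natrM -natrM ler_nat; have := divn_eq N q; have := ltn_pmod N q0.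
  have : (q <= N %/ q * q)%N by rewrite -{1}[q]mul1n leq_mul2r S0 orbT.
  lia.
have Su : u ^+ 2 <= 6 * S.
  rewrite -(ler_pM2r u0) -exprSr (le_trans Sq) //.
  rewrite (_ : 6 * S * u = 2 * S * (3 * u)); last by ring.
  by rewrite ler_wpM2l // mulr_ge0 // ltW.
have e1 : (N%:R `^ (7 / 12)) ^+ 4 = N%:R * u ^+ 4.
  rewrite -{2}[N%:R](powRr1 (ltW NR)) /u -!powR_mulrn ?powR_ge0 // -!powRrM.
  by rewrite -powRD ?gt_eqF ?implybT //; congr (_ `^ _); field.
have e2 : Num.sqrt S ^+ 4 = S ^+ 2 by rewrite (exprM _ 2 2) sqr_sqrtr // ltW.
rewrite !exprMn e1 e2.
(* Fourth powers require 16 / 5^4 = (4/25)^2, and S >= u^2 / 6 suffices because 4/25 < 1/6. *)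
have key : 4 / 25 * u ^+ 2 <= S by lra.
have key2 : (4 / 25 * u ^+ 2) ^+ 2 <= S ^+ 2.
  by rewrite lerXn2r ?nnegrE ?(ltW SR) // mulr_ge0 ?sqr_ge0 // divr_ge0.
rewrite (_ : _ * S ^+ 2 = N%:R / 16 * S ^+ 2 * (4 / 25 * u ^+ 2) ^+ 2); last by field.
rewrite [leRHS](_ : _ = N%:R / 16 * S ^+ 2 * S ^+ 2); last by field.
by rewrite ler_wpM2l // mulr_ge0 ?sqr_ge0 // divr_ge0.
Qed.

End LowerBound.

Theorem theorem1 (R : realType) :
  (exists C : R, 0 < C /\
     forall N : nat, (10 <= N)%N ->
       exists (a br bi : nat -> R),
         unif_convex N a /\ 0 < l2norm N br bi /\
         (L4norm N (maxfun N a br bi) >=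
            (C * powR (N%:R) (7 / 12) * l2norm N br bi)%:E)%E)
  /\
  (forall eps : R, 0 < eps ->
     exists Ceps : R, 0 < Ceps /\
       forall N : nat, (1 <= N)%N ->
         forall (a br bi : nat -> R), unif_convex N a ->
           (L4norm N (maxfun N a br bi) <=
              (Ceps * powR (N%:R) eps * powR (N%:R) (7 / 12)
                 * l2norm N br bi)%:E)%E).
Proof.
split=> [|eps eps0]; last exact: maximal_estimate.
by exists 5^-1; split=> [|N]; [rewrite invr_gt0 | exact: maximal_sharp].
Qed.
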